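(* Let $M$ be a Riemannian manifold, let $\mu$ be a Borel probability measure on $M$ and $\nu$ a positive Borel measure on $M$. Let $q\in[1/2,1)$ and $c:=\frac{\log2}{2\log(1+2e^2)}$. Assume that $(\mu,\nu)$ satisfies a weak logarithmic Sobolev inequality with function $h_{WLS}$. Then $(\mu,\nu)$ satisfies an $L^q$-logarithmic Sobolev inequality if $$\int_0^{1/2}h_{WLS}(c\,t)^{q/(1-q)}\,dt<+\infty.$$
   Context: $\mathrm{Ent}_\mu(g):=\int g\log(g/\int g\,d\mu)\,d\mu$ for $g\ge0$; $\mathrm{Osc}_\mu(f):=\operatorname{ess\,sup}_\mu f-\operatorname{ess\,inf}_\mu f$. $(\mu,\nu)$ satisfies a weak logarithmic Sobolev inequality with function $h_{WLS}$ (positive, non-increasing on $(0,\infty)$) if for all bounded $f\in C^1(M)$ and all $s>0$: $\mathrm{Ent}_\mu(f^2)\le h_{WLS}(s)\int|\nabla f|^2d\nu+s[\mathrm{Osc}_\mu(f)]^2$. $(\mu,\nu)$ satisfies an $L^q$-logarithmic Sobolev inequality if there is a constant $C_{LS}$ such that for all non-negative $f\in C^1(M)$: $[\mathrm{Ent}_\mu(f^{2q})]^{1/q}\le C_{LS}\int|\nabla f|^2d\nu$. *)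

(* Defs.v *)
From HB Require Import structures.
From mathcomp Require Import all_boot all_order all_algebra.
From mathcomp Require Import all_classical all_reals all_analysis.
From mathcomp Require Import ess_sup_inf.

Set Implicit Arguments.
Unset Strict Implicit.
Unset Printing Implicit Defensive.

Import Order.TTheory GRing.Theory Num.Theory.
Import numFieldNormedType.Exports.

Local Open Scope classical_set_scope.
Local Open Scope ring_scope.

(* f is of class C^k on the open set U: derivatives are Frechet derivatives,
   and since the source is finite-dimensional, x |-> 'd f x is C^k iff
   x |-> 'd f x v is C^k for every direction v. *)
Fixpoint Ck_on (R : realType) (n : nat) (W : normedModType R) (k : nat)
    (U : set 'rV[R]_n) (f : 'rV[R]_n -> W) : Prop :=
  match k with
  | 0%N => forall x, U x -> {for x, continuous f}
  | k'.+1 => (forall x, U x -> differentiable f x) /\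
             forall v : 'rV[R]_n, Ck_on k' U (fun x => 'd f x v)
  end.

Definition smooth_on (R : realType) (n : nat) (W : normedModType R)
    (U : set 'rV[R]_n) (f : 'rV[R]_n -> W) : Prop :=
  forall k, Ck_on k U f.

(* Only the values of chart_map on chart_dom, and those of chart_inv on
   chart_cod, are meaningful. *)
Record chart (R : realType) (n : nat) (M : topologicalType) := Chart {
  chart_dom : set M;
  chart_map : M -> 'rV[R]_n;
  chart_inv : 'rV[R]_n -> M;
  chart_cod := chart_map @` chart_dom;
  chart_dom_open : open chart_dom;
  chart_cod_open : open chart_cod;
  chart_mapK : forall p, chart_dom p -> chart_inv (chart_map p) = p;
  chart_map_continuous : {within chart_dom, continuous chart_map};
  chart_inv_continuous : {within chart_cod, continuous chart_inv}
}.

Definition transition (R : realType) (n : nat) (M : topologicalType)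
    (a b : chart R n M) : 'rV[R]_n -> 'rV[R]_n :=
  chart_map b \o chart_inv a.

Definition overlap (R : realType) (n : nat) (M : topologicalType)
    (a b : chart R n M) : set 'rV[R]_n :=
  chart_map a @` (chart_dom a `&` chart_dom b).

(* A Hausdorff, second countable smooth manifold of dimension n, with a smooth
   Riemannian metric. metric a x is the Gram matrix, at the point of coordinates
   x in the chart a, of the coordinate vector fields of a. Tangent vectors are
   row vectors; as v *m 'J t x = 'd t x v, the change of coordinates reads
   G_a = J *m G_b *m J^T. *)
Record riemannian_manifold (R : realType) (n : nat) (M : topologicalType) :=
  RiemannianManifold {
  rm_hausdorff : hausdorff_space M;
  rm_second_countable : @second_countable M;
  atlas : set (chart R n M);
  atlas_cover : forall p : M, exists a, atlas a /\ chart_dom a p;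
  atlas_smooth : forall a b, atlas a -> atlas b ->
    smooth_on (overlap a b) (transition a b);
  metric : chart R n M -> 'rV[R]_n -> 'M[R]_n;
  metric_smooth : forall a, atlas a -> smooth_on (chart_cod a) (metric a);
  metric_sym : forall a x, atlas a -> chart_cod a x ->
    (metric a x)^T = metric a x;
  metric_posdef : forall a x, atlas a -> chart_cod a x ->
    forall v : 'rV[R]_n, v != 0 -> 0 < (v *m metric a x *m v^T) 0 0;
  metric_transition : forall a b x, atlas a -> atlas b -> overlap a b x ->
    metric a x = 'J (transition a b) x *m metric b (transition a b x)
                 *m ('J (transition a b) x)^T
}.

Definition C1 (R : realType) (n : nat) (M : topologicalType)
    (X : riemannian_manifold R n M) (f : M -> R) : Prop :=
  forall a, atlas X a -> Ck_on 1 (chart_cod a) (f \o chart_inv a).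

Definition chart_at (R : realType) (n : nat) (M : topologicalType)
    (X : riemannian_manifold R n M) (p : M) : chart R n M :=
  projT1 (cid (atlas_cover X p)).

(* Components of the gradient at p in the chart a: raise the index of the
   differential with the inverse metric. *)
Definition gradient_in (R : realType) (n : nat) (M : topologicalType)
    (X : riemannian_manifold R n M) (a : chart R n M) (f : M -> R) (p : M) :
    'rV[R]_n :=
  let x := chart_map a p in
  (\row_(i < n) 'd (f \o chart_inv a) x (delta_mx 0 i)) *m invmx (metric X a x).

(* |grad f|(p), computed in one chart of the atlas around p; for f of class C^1
   metric_transition makes the value independent of that chart. *)
Definition grad_norm (R : realType) (n : nat) (M : topologicalType)
    (X : riemannian_manifold R n M) (f : M -> R) (p : M) : R :=
  let a := chart_at X p in
  let v := gradient_in X a f p in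
  Num.sqrt ((v *m metric X a (chart_map a p) *m v^T) 0 0).

Notation borel M := (g_sigma_algebraType (@open M)).

(* For mu finite and g >= 0 of finite integral, the negative part of
   g log (g / int g) is bounded, so that the integral makes sense in (-oo, +oo];
   0 log 0 = 0 as ln 0 = 0. If g is not integrable, Ent_mu(g) = +oo. *)
Definition Ent (d : measure_display) (T : measurableType d) (R : realType)
    (mu : {measure set T -> \bar R}) (g : T -> R) : \bar R :=
  let m := (\int[mu]_x (g x)%:E)%E in
  if m == +oo%E then +oo%E
  else (\int[mu]_x (g x * ln (g x / fine m))%:E)%E.

Definition Osc (d : measure_display) (T : measurableType d) (R : realType)
    (mu : {measure set T -> \bar R}) (f : T -> R) : \bar R :=
  (ess_sup mu (EFin \o f) - ess_inf mu (EFin \o f))%E.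

Definition weak_log_sobolev (R : realType) (n : nat) (M : ptopologicalType)
    (X : riemannian_manifold R n M)
    (mu nu : {measure set (borel M) -> \bar R}) (h : R -> R) : Prop :=
  [/\ forall s, 0 < s -> 0 < h s,
      forall s t, 0 < s -> s <= t -> h t <= h s
    & forall f : M -> R, C1 X f -> bounded_fun f -> forall s : R, 0 < s ->
      (Ent mu (fun x => (f x ^+ 2)%R) <=
        (h s)%:E * \int[nu]_x (grad_norm X f x ^+ 2)%:E
        + s%:E * Osc mu f ^+ 2)%E].

Definition Lq_log_sobolev (R : realType) (n : nat) (M : ptopologicalType)
    (X : riemannian_manifold R n M)
    (mu nu : {measure set (borel M) -> \bar R}) (q : R) : Prop :=
  exists2 C : R, 0 < C &
    forall f : M -> R, C1 X f -> (forall x, 0 <= f x) ->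
      (Ent mu (fun x => (f x `^ (2 * q))%R) `^ q^-1 <=
        C%:E * \int[nu]_x (grad_norm X f x ^+ 2)%:E)%E.

(* Main.v *)
Require Import Defs.
From HB Require Import structures.
From mathcomp Require Import all_boot all_order all_algebra.
From mathcomp Require Import all_classical all_reals all_analysis.
From mathcomp Require Import measurable_realfun ess_sup_inf.
From mathcomp Require Import ring lra.
Import Order.TTheory GRing.Theory Num.Theory.
Import numFieldNormedType.Exports.
Local Open Scope classical_set_scope.
Local Open Scope ring_scope.

(* Let m be a median of f and b^2 the energy of f. Testing the weak inequality on
   cutoffs of z = (f - m) / b between the levels 2^(k-1) and 2^k, and bounding the
   entropy of the cutoff below by u_k = a_k log (1 + 1 / (2 a_k)) with
   a_k = mu (z >= 2^k), the choice s = u_k / 2 gives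
   4^k u_k / h (u_k / 2) <= 32 E_k, where E_k is the energy in the k-th layer and
   the E_k sum to at most 1. Since the u_k are nonincreasing, Abel summation
   replaces sum 4^(kq) u_k by sum 4^(kq) (u_k - u_(k+1)), and Hoelder's inequality
   bounds the latter by the layer energies and by sum (u_k - u_(k+1)) h (u_k / 2)^(q/(1-q)),
   a lower Riemann sum of the integral in the hypothesis, because u_k <= 1/2.
   The same applies to -z, and these weighted sums control both the integral of
   |f - m|^(2q) and the logarithmic part of Ent (f^(2q)), the latter through the
   variational bound Ent F <= int (F log (F / t) - F + t) at t = (m + b)^(2q). *)

(** * Integrals of non-negative, possibly non-measurable functions *)

(* The library's integral of a non-negative function is the supremum over the simple
   functions below it, hence monotone and superadditive without measurability; this
   spares proving that grad_norm and h are measurable. *)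
Section lower_integral.
Local Open Scope ereal_scope.
Context {d} {T : measurableType d} {R : realType}.
Variable mu : {measure set T -> \bar R}.
Implicit Types f g : T -> \bar R.

Import HBNNSimple.

Lemma ge0_integral_supP f (y : \bar R) : (forall x, 0 <= f x) ->
  (forall h : {nnsfun T >-> R}, (forall x, (h x)%:E <= f x) ->
     \int[mu]_x (h x)%:E <= y) ->
  \int[mu]_x f x <= y.
Proof.
move=> f0 fy; rewrite ge0_integralTE//; apply: ge_ereal_sup => _ [h hf <-].
by rewrite -integralT_nnsfun; exact: fy.
Qed.

Lemma nnsfun_le_integral f (h : {nnsfun T >-> R}) :
  (forall x, (h x)%:E <= f x) -> \int[mu]_x (h x)%:E <= \int[mu]_x f x.
Proof.
move=> hf; have f0 x : 0 <= f x by apply: le_trans (hf x); rewrite lee_fin.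
rewrite [leRHS]ge0_integralTE//; apply: ereal_sup_ubound.
by exists h => //; rewrite integralT_nnsfun.
Qed.

Lemma le_integral_nomeas f g : (forall x, 0 <= f x) -> (forall x, f x <= g x) ->
  \int[mu]_x f x <= \int[mu]_x g x.
Proof.
move=> f0 fg; apply: ge0_integral_supP => // h hf; apply: nnsfun_le_integral.
by move=> x; exact: le_trans (hf x) (fg x).
Qed.

(** The sum of a simple function below [f] and one below [g] is a simple function below [f + g]. The
    two suprema are taken one at a time, each time subtracting a finite integral, hence the case
    distinctions on [+oo]. *)
Lemma integralD_ge_nomeas f g : (forall x, 0 <= f x) -> (forall x, 0 <= g x) ->
  \int[mu]_x f x + \int[mu]_x g x <= \int[mu]_x (f x + g x).
Proof.
move=> f0 g0; have fg0 x : 0 <= f x + g x by rewrite adde_ge0.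
have [gy|gNy] := eqVneq (\int[mu]_x g x) +oo.
  suff -> : \int[mu]_x (f x + g x) = +oo by rewrite leey.
  apply/eqP; rewrite eq_le leey/= -gy; apply: le_integral_nomeas => // x.
  by rewrite leeDr.
have gfin : \int[mu]_x g x \is a fin_num.
  by rewrite ge0_fin_numE ?integral_ge0// lt_neqAle gNy leey.
rewrite -leeBrDr//; apply: ge0_integral_supP => // h hf.
have hfin : forall k : {nnsfun T >-> R}, (forall x, (k x)%:E <= g x) ->
    \int[mu]_x (k x)%:E \is a fin_num.
  move=> k kg; have := nnsfun_le_integral _ _ kg.
  have k0 : 0 <= \int[mu]_x (k x)%:E.
    by apply: integral_ge0 => x _; rewrite lee_fin.
  by rewrite ge0_fin_numE// => /le_lt_trans; apply; rewrite -ge0_fin_numE ?integral_ge0.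
rewrite leeBrDr// addeC.
have [hy|hNy] := eqVneq (\int[mu]_x (h x)%:E) +oo.
  suff -> : \int[mu]_x (f x + g x) = +oo by rewrite leey.
  apply/eqP; rewrite eq_le leey/= -hy; apply: nnsfun_le_integral => x.
  by rewrite (le_trans (hf x))// leeDl.
have hhfin : \int[mu]_x (h x)%:E \is a fin_num.
  by rewrite ge0_fin_numE ?lt_neqAle ?hNy ?leey// integral_ge0// => x _; rewrite lee_fin.
rewrite -leeBrDr//; apply: ge0_integral_supP => // k kg.
rewrite leeBrDr// addeC !integralT_nnsfun -sintegralD// -integralT_nnsfun.
by apply: nnsfun_le_integral => x /=; rewrite EFinD leeD.
Qed.

Lemma integral_sum_ge_nomeas n (F : nat -> T -> \bar R) :
  (forall k x, 0 <= F k x) ->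
  \sum_(k < n) \int[mu]_x F k x <= \int[mu]_x (\sum_(k < n) F k x).
Proof.
move=> F0; elim: n => [|n ih].
  by rewrite big_ord0 integral_ge0// => x _; rewrite big_ord0.
rewrite big_ord_recr/=; apply: (le_trans (leeD ih (lexx _))).
apply: (le_trans (integralD_ge_nomeas _ _ _ _)) => //.
  by move=> x; apply: sume_ge0.
apply: le_integral_nomeas => x; first by rewrite adde_ge0 ?sume_ge0.
by rewrite big_ord_recr.
Qed.

Lemma integralZl_ge_nomeas f (k : R) : (0 < k)%R -> (forall x, 0 <= f x) ->
  k%:E * \int[mu]_x f x <= \int[mu]_x (k%:E * f x).
Proof.
move=> k0 f0; rewrite -lee_pdivlMl//; apply: ge0_integral_supP => // h hf.
rewrite lee_pdivlMl// integralT_nnsfun.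
pose kk : {nonneg R} := NngNum (ltW k0).
rewrite -[k]/(kk%:num)%R -sintegralrM.
have -> : (cst (kk%:num) \* h)%R = scale_nnsfun h (ltW k0) :> (T -> R) by [].
rewrite -integralT_nnsfun; apply: nnsfun_le_integral => x /=.
by rewrite EFinM lee_pmul2l// lte_fin.
Qed.

(** The missing inequality is the previous one for the factor [k^-1]. *)
Lemma integralZl_nomeas f (k : R) : (0 < k)%R -> (forall x, 0 <= f x) ->
  \int[mu]_x (k%:E * f x) = k%:E * \int[mu]_x f x.
Proof.
move=> k0 f0; apply/eqP; rewrite eq_le integralZl_ge_nomeas// andbT.
have kV0 : (0 < k^-1)%R by rewrite invr_gt0.
rewrite -lee_pdivrMl// (le_trans (integralZl_ge_nomeas _ _ kV0 _))//.
  by move=> x; rewrite mule_ge0// lee_fin ltW.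
rewrite (eq_integral f)// => x _.
by rewrite muleA -EFinM mulVf ?gt_eqF// mul1e.
Qed.

Lemma sum_disjoint_le n (F : nat -> T -> \bar R) f :
  (forall k x, F k x <= f x) -> (forall x, 0 <= f x) ->
  (forall x j k, (j < k)%N -> F j x = 0 \/ F k x = 0) ->
  forall x, \sum_(k < n) F k x <= f x.
Proof.
move=> Ff f0 disj x; have [[k Fk]|no] := pselect (exists k : 'I_n, F k x != 0).
  rewrite (bigD1 k)//= big1 ?adde0// => j jk.
  have : (j < k)%N \/ (k < j)%N by apply/orP; rewrite -neq_ltn.
  move=> [jk'|kj]; [have []//:= disj x _ _ jk'|have []//:= disj x _ _ kj] => Fk0;
  by move: Fk; rewrite Fk0 eqxx.
rewrite big1// => k _; apply/eqP/negP => /negP Fk; apply: no; by exists k.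
Qed.

(** Serves twice: for the Riemann sum of [h] over disjoint intervals, and for the energies of the
    dyadic layers. *)
Lemma integral_sum_disjoint_le n (F : nat -> T -> \bar R) f :
  (forall k x, 0 <= F k x) -> (forall k x, F k x <= f x) ->
  (forall x j k, (j < k)%N -> F j x = 0 \/ F k x = 0) ->
  \sum_(k < n) \int[mu]_x F k x <= \int[mu]_x f x.
Proof.
move=> F0 Ff disj; apply: (le_trans (integral_sum_ge_nomeas n _ F0)).
apply: le_integral_nomeas => x; first exact: sume_ge0.
by apply: sum_disjoint_le => // y; exact: le_trans (F0 0%N y) (Ff 0%N y).
Qed.

End lower_integral.

(** * The entropy profile and the discrete Hoelder argument *)

Section real_lemmas.
Context {R : realType}.
Implicit Types a b q x y : R.

Lemma ln_le_subr1 x : 0 < x -> ln x <= x - 1.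
Proof. by move=> x0; rewrite -[x in ln x](addrNK 1) addrC le_ln1Dx//; lra. Qed.

Lemma ln_ge_subr1V x : 0 < x -> 1 - x^-1 <= ln x.
Proof.
move=> x0; have := @ln_le_subr1 x^-1; rewrite invr_gt0 => /(_ x0).
by rewrite lnV ?posrE//; lra.
Qed.

Lemma ln2_gt0 : 0 < ln 2 :> R.
Proof. by rewrite ln_gt0// ltr1n. Qed.

(** A lower bound for the entropy of a function that is 1 on a set of measure [a] and supported in a
    set of measure at most 1/2. At [a = 0] the first factor gives the limit value 0. *)
Definition capl a : R := a * ln (1 + (2 * a)^-1).

Lemma capl0 : capl 0 = 0. Proof. by rewrite /capl mul0r. Qed.

Lemma capl_ge0 a : 0 <= a -> 0 <= capl a.
Proof.
move=> a0; rewrite mulr_ge0// ln_ge0// lerDl invr_ge0; lra.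
Qed.

Lemma capl_le_half a : 0 <= a -> capl a <= 2^-1.
Proof.
rewrite le_eqVlt => /predU1P[<-|a0]; first by rewrite capl0 invr_ge0.
rewrite /capl (@le_trans _ _ (a * (2 * a)^-1))//; last first.
  by rewrite invfM mulrCA divff ?gt_eqF// mulr1.
apply: ler_wpM2l; first exact: ltW.
apply: le_ln1Dx; apply: (@lt_trans _ _ 0); first by rewrite oppr_lt0.
by rewrite invr_gt0 mulr_gt0.
Qed.

(** Write b ln y - a ln x = (b - a) ln y - a (ln x - ln y) and bound both logarithms by ln t <= t -
    1. The resulting bounds cancel exactly, because a x - a = b y - b = 1/2. *)
Lemma capl_homo a b : 0 <= a -> a <= b -> capl a <= capl b.
Proof.
rewrite le_eqVlt => /predU1P[<- b0|a0 ab]; first by rewrite capl0 capl_ge0.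
have b0 : 0 < b by exact: lt_le_trans ab.
rewrite /capl; set x := 1 + (2 * a)^-1; set y := 1 + (2 * b)^-1.
have x0 : 0 < x by rewrite addr_gt0// invr_gt0 mulr_gt0.
have y0 : 0 < y by rewrite addr_gt0// invr_gt0 mulr_gt0.
have h1 : ln x - ln y <= x / y - 1.
  by rewrite -ln_div ?posrE// ln_le_subr1// divr_gt0.
have h2 : - ln y <= y^-1 - 1 by have := ln_ge_subr1V _ y0; lra.
have : a * (ln x - ln y) <= a * (x / y - 1) by rewrite ler_wpM2l// ltW.
have : (b - a) * (- ln y) <= (b - a) * (y^-1 - 1).
  by rewrite ler_wpM2l// subr_ge0.
have -> : (b - a) * (y^-1 - 1) = - (a * (x / y - 1)).
  have bx : a * x = b * y + a - b.
    rewrite /x /y !mulrDr !mulr1 !invfM ![_ * (2^-1 * _)]mulrCA !divff ?gt_eqF//.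
    ring.
  have -> : a * (x / y - 1) = a * x / y - a by ring.
  by rewrite bx; field; exact: lt0r_neq0.
lra.
Qed.

Lemma capl_ge_ln2 a : 0 <= a -> a <= 2^-1 -> a * ln 2 <= capl a.
Proof.
rewrite le_eqVlt => /predU1P[<- _|a0 ha]; first by rewrite mul0r capl0.
rewrite /capl ler_pM2l// ler_ln ?posrE ?addr_gt0 ?invr_gt0 ?mulr_gt0//.
rewrite -[2]/(1 + 1 : R) lerD2l -[leLHS]invr1 lef_pV2 ?posrE ?mulr_gt0//; lra.
Qed.

Lemma capl_ge_lnV a : 0 < a -> a * ln (2 * a)^-1 <= capl a.
Proof.
move=> a0; rewrite /capl ler_pM2l// ler_ln ?posrE ?addr_gt0 ?invr_gt0 ?mulr_gt0//.
by rewrite lerDr.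
Qed.

(** Since the weights at least double, w_(k+1) - w_k is at least half of w_(k+1), so summation by
    parts loses at most a factor 2. The boundary term carries the induction. *)
Lemma abel_sum_ge (w u : nat -> R) (K : nat) :
  (forall k, 0 <= u k) -> (forall k, 0 <= w k) -> (forall k, 2 * w k <= w k.+1) ->
  2^-1 * (\sum_(k < K) w k * u k) <=
  \sum_(k < K) w k * (u k - u k.+1) + w K * u K / 2.
Proof.
move=> u0 w0 w2; elim: K => [|K ih].
  by rewrite !big_ord0 mulr0 add0r divr_ge0// mulr_ge0.
rewrite !big_ord_recr/=.
have : 2 * w K * u K.+1 <= w K.+1 * u K.+1 by rewrite ler_wpM2r.
by move: ih; lra.
Qed.

(** One term of Hoelder's inequality with exponents 1/q and 1/(1-q): Young's inequality for x/X and
    y/Y. In x^q y^(1-q) the powers of [H] cancel and W^q u^q dd^(1-q) remains, where u^q >= dd^q. *)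
Lemma young_term q W u dd H X Y : 0 < q < 1 -> 0 <= W -> 0 <= dd -> dd <= u ->
  0 < H -> 0 < X -> 0 < Y ->
  W `^ q * dd <= X `^ q * Y `^ (1 - q) *
    (q * (W * u / H / X) + (1 - q) * (dd * H `^ (q / (1 - q)) / Y)).
Proof.
move=> /andP[q0 q1] W0 d0 du H0 X0 Y0.
have q1' : 0 < 1 - q by rewrite subr_gt0.
have u0 : 0 <= u by exact: le_trans du.
set x := W * u / H; set y := dd * H `^ _.
have x0 : 0 <= x by rewrite divr_ge0 ?mulr_ge0// ltW.
have y0 : 0 <= y by rewrite mulr_ge0// powR_ge0.
have xX : 0 <= x / X by rewrite divr_ge0// ltW.
have yY : 0 <= y / Y by rewrite divr_ge0// ltW.
have yg : (x / X) `^ q * (y / Y) `^ (1 - q) <= q * (x / X) + (1 - q) * (y / Y).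
  have := @conjugate_powR R ((x / X) `^ q) ((y / Y) `^ (1 - q)) q^-1 (1 - q)^-1.
  rewrite !invrK -!powRrM !divff ?gt_eqF// !powRr1//.
  rewrite [q * _]mulrC [(1 - q) * _]mulrC.
  by apply; rewrite ?powR_ge0 ?invr_gt0//; lra.
apply: le_trans (ler_wpM2l _ yg); last by rewrite mulr_ge0 ?powR_ge0.
have XK : X `^ q * (x / X) `^ q = x `^ q.
  by rewrite -powRM ?(ltW X0)// mulrC divfK ?gt_eqF.
have YK : Y `^ (1 - q) * (y / Y) `^ (1 - q) = y `^ (1 - q).
  by rewrite -powRM ?(ltW Y0)// mulrC divfK ?gt_eqF.
rewrite mulrACA XK YK /x /y.
have H0' := ltW H0.
rewrite !powRM ?invr_ge0 ?mulr_ge0 ?powR_ge0// -powRrM divfK ?gt_eqF//.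
have -> : H^-1 `^ q = (H `^ q)^-1 by rewrite -powRN -powR_inv1// -powRrM mulN1r.
have -> : W `^ q * u `^ q / H `^ q * (dd `^ (1 - q) * H `^ q) =
    W `^ q * (u `^ q * dd `^ (1 - q)).
  by field; rewrite gt_eqF// powR_gt0.
rewrite ler_wpM2l ?powR_ge0//.
have [->|dn0] := eqVneq dd 0; first by rewrite mulr_ge0 ?powR_ge0.
rewrite (@le_trans _ _ (dd `^ q * dd `^ (1 - q)))//.
  by rewrite -powRD ?dn0 ?implybT// subrKC powRr1.
by rewrite ler_wpM2r ?powR_ge0// ge0_ler_powR ?nnegrE// ltW.
Qed.

(* Hoelder's inequality applied after an Abel summation: passing from the [u k] to
   the increments [u k - u k.+1] is what turns the second factor into a Riemann sum. *)
Lemma dyadic_sum_le q X Y (K : nat) (u H : nat -> R) :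
  2^-1 <= q < 1 -> 0 < X -> 0 < Y ->
  (forall k, 0 <= u k) -> (forall k, u k.+1 <= u k) -> u K = 0 ->
  (forall k, 0 < u k -> 0 < H k) ->
  \sum_(k < K) 4 ^+ k * u k / H k <= X ->
  \sum_(k < K) (u k - u k.+1) * H k `^ (q / (1 - q)) <= Y ->
  \sum_(k < K) (4 ^+ k) `^ q * u k <= 2 * (X `^ q * Y `^ (1 - q)).
Proof.
move=> /andP[hq q1] X0 Y0 u0 uS uK H0 hX hY.
have q0 : 0 < q by apply: lt_le_trans hq; rewrite invr_gt0.
(* Here q >= 1/2 enters: it makes the weights 4^(kq) double from one level to the next. *)
have four : 2 <= (4 : R) `^ q.
  rewrite (@le_trans _ _ (4 `^ 2^-1))//; last by rewrite ler_powR// ler1n.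
  by rewrite powR12_sqrt// (_ : 4 = 2 ^+ 2) ?sqrtr_sqr ?normr_nat//; ring.
have w0 k : 0 <= (4 ^+ k : R) `^ q by exact: powR_ge0.
have w2 k : 2 * (4 ^+ k : R) `^ q <= (4 ^+ k.+1) `^ q.
  by rewrite exprS powRM ?exprn_ge0// ler_wpM2r.
have := @abel_sum_ge (fun k => (4 ^+ k) `^ q) u K u0 w0 w2.
rewrite uK mulr0 mul0r addr0 => ab.
suff : \sum_(k < K) (4 ^+ k) `^ q * (u k - u k.+1) <= X `^ q * Y `^ (1 - q) by lra.
have XY0 : 0 <= X `^ q * Y `^ (1 - q) by rewrite mulr_ge0 ?powR_ge0.
apply: (@le_trans _ _ (\sum_(k < K) X `^ q * Y `^ (1 - q) *
    (q * (4 ^+ k * u k / H k / X) +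
     (1 - q) * ((u k - u k.+1) * H k `^ (q / (1 - q)) / Y)))).
  (* [H k] is known to be positive only where [u k] is; where [u k = 0] the increment vanishes too
     and both sides are 0. *)
  apply: ler_sum => k _; have := u0 k; rewrite le_eqVlt => /predU1P[uk0|uk].
    have -> : u k.+1 = 0 by apply/eqP; rewrite eq_le u0 uk0 uS.
    by rewrite -uk0 subrr !(mulr0, mul0r, addr0).
  apply: young_term => //; rewrite ?q0 ?exprn_ge0 ?subr_ge0 ?uS ?H0//.
  by rewrite gerBl.
rewrite -mulr_sumr ler_piMr// big_split/= -!mulr_sumr -!mulr_suml.
have : (\sum_(k < K) 4 ^+ k * u k / H k) / X <= 1 by rewrite ler_pdivrMr// mul1r.
move=> /(ler_wpM2l (ltW q0)).
have : (\sum_(k < K) (u k - u k.+1) * H k `^ (q / (1 - q))) / Y <= 1.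
  by rewrite ler_pdivrMr// mul1r.
have q1' : 0 <= 1 - q by rewrite subr_ge0 ltW.
by move=> /(ler_wpM2l q1'); lra.
Qed.

End real_lemmas.

(** For t between [u k.+1] and [u k], c <= 1/2 gives c t <= u_k / 2, hence h (c t) >= h (u_k / 2).
    These intervals are disjoint and lie in (0, 1/2). *)
Lemma riemann_sum_le {R : realType} (h : R -> R) (c r : R) (u : nat -> R) (K : nat) :
  0 < c -> c <= 2^-1 -> 0 <= r ->
  (forall s, 0 < s -> 0 < h s) -> (forall s t, 0 < s -> s <= t -> h t <= h s) ->
  (forall k, 0 <= u k) -> (forall k, u k.+1 <= u k) -> u 0%N <= 2^-1 ->
  ((\sum_(k < K) (u k - u k.+1) * h (u k / 2) `^ r)%:E <=
   \int[lebesgue_measure]_(t in `]0%R, 2^-1%R[) (h (c * t) `^ r)%:E)%E.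
Proof.
move=> c0 c2 r0 h0 hdec u0 uS u0le.
have ulek j k : (j <= k)%N -> u k <= u j.
  elim: k => [|k ih]; rewrite leq_eqVlt => /predU1P[->//|]//.
  by rewrite ltnS => /ih; apply: le_trans.
pose F (k : nat) (t : R) : \bar R :=
  ((h (u k / 2) `^ r)%:E * (\1_(`]u k.+1, u k[%classic : set R) t)%:E)%E.
have F0 k t : (0 <= F k t)%E by rewrite mule_ge0// lee_fin ?powR_ge0.
rewrite integral_mkcond; apply: (@le_trans _ _ (\sum_(k < K) \int[lebesgue_measure]_x F k x)%E).
  rewrite -sumEFin; apply: lee_sum => k _.
  rewrite /F ge0_integralZl_EFin//; last 2 first.
    exact/measurable_EFinP/measurable_indic.
    exact: powR_ge0.
  rewrite integral_indic// setIT.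
  rewrite /= lebesgue_measure_itv/= lte_fin.
  case: ifPn => [_|]; first by rewrite -EFinD -EFinM mulrC.
  rewrite -leNgt => uk; have -> : u k.+1 = u k by apply/eqP; rewrite eq_le uS.
  by rewrite subrr mul0r mule0.
apply: integral_sum_disjoint_le => //.
  move=> k t; rewrite /F indicE /patch.
  have [/=|_] := boolP (t \in `]u k.+1, u k[%classic); last first.
    by rewrite mule0; case: ifP => // _; rewrite lee_fin powR_ge0.
  rewrite inE/= in_itv/= => /andP[ut tu].
  have t0 : 0 < t by exact: le_lt_trans ut.
  have uk : u k <= 2^-1 by exact: le_trans (ulek 0%N k isT) _.
  have -> : t \in `]0, 2^-1[%classic by rewrite inE/= in_itv/= t0 (lt_le_trans tu).
  rewrite mule1 lee_fin ge0_ler_powR ?nnegrE//.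
  - by apply/ltW/h0; rewrite divr_gt0// (lt_trans t0).
  - by apply/ltW/h0; rewrite mulr_gt0.
  - apply: hdec; first by rewrite mulr_gt0.
    by rewrite mulrC ler_pM// ltW.
move=> t j k jk; rewrite /F !indicE.
have [/=|_] := boolP (t \in `]u j.+1, u j[%classic); last by left; rewrite mule0.
have [/=|_] := boolP (t \in `]u k.+1, u k[%classic); last by right; rewrite mule0.
rewrite !inE/= !in_itv/= => /andP[_ tk] /andP[jt _].
by have := ulek _ _ jk; rewrite leNgt (lt_trans jt tk).
Qed.

(** * Chain rule on the manifold and cutoffs *)

Section manifold_calculus.
Context {R : realType} {n : nat} {M : ptopologicalType}.
Variable X : riemannian_manifold R n M.
Implicit Types (f : M -> R) (xi dxi : R -> R).

Lemma C1_continuous f : C1 X f -> continuous f.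
Proof.
move=> f1 p; have [a [aX ap]] := atlas_cover X p.
have [df _] := f1 a aX.
have cod : chart_cod a (chart_map a p) by exists p.
have fc : {for chart_map a p, continuous (f \o chart_inv a)}.
  exact/differentiable_continuous/df.
have mc : {for p, continuous (chart_map a)}.
  have := @chart_map_continuous _ _ _ a.
  by rewrite continuous_open_subspace; [apply; rewrite inE|exact: chart_dom_open].
have := continuous_comp mc fc.
rewrite /prop_for /continuous_at /= chart_mapK// => h.
apply: cvg_trans h; apply: near_eq_cvg.
have : nbhs p (chart_dom a) by apply: open_nbhs_nbhs; split => //; exact: chart_dom_open.
by apply: filterS => y ay /=; rewrite chart_mapK.
Qed.

Lemma diff_comp_real (V : normedModType R) (F : V -> R) xi (d : R) (x : V) :
  differentiable F x -> is_derive (F x) 1 xi d ->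
  differentiable (xi \o F) x /\ forall v, 'd (xi \o F) x v = d * 'd F x v.
Proof.
move=> dF [dxi xid].
have dx : differentiable xi (F x) by exact/derivable1_diffP.
split; first exact: differentiable_comp.
by move=> v; rewrite diff_comp//= deriv1E// derive1E xid /= mulrC.
Qed.

Lemma C1_comp f xi dxi : C1 X f -> (forall x : R, is_derive x 1 xi (dxi x)) ->
  continuous dxi -> C1 X (xi \o f).
Proof.
move=> f1 dxiP cdxi a aX; have [df cdf] := f1 a aX.
split.
  by move=> x Ux; have [] := diff_comp_real _ _ _ _ _ (df x Ux) (dxiP _).
move=> v x Ux /=.
have cF : {for x, continuous (f \o chart_inv a)} by exact/differentiable_continuous/df.
have hd (y : 'rV[R]_n) : chart_cod a y -> 'd (xi \o f \o chart_inv a) y v =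
    dxi (f (chart_inv a y)) * 'd (f \o chart_inv a) y v.
  by move=> Uy; have [_] := diff_comp_real _ _ _ _ _ (df y Uy) (dxiP _); apply.
have cprod : {for x, continuous (fun y : 'rV[R]_n => dxi (f (chart_inv a y)) *
    'd (f \o chart_inv a) y v)}.
  apply: continuousM; last exact: cdf.
  apply: (@continuous_comp _ _ _ (f \o chart_inv a) dxi) => //; exact: cdxi.
have Ux' : nbhs x (chart_cod a) by apply: open_nbhs_nbhs; split => //; exact: chart_cod_open.
rewrite /prop_for /continuous_at [X in _ --> X](hd x Ux).
(* The product formula for the differential is known only on the open set [chart_cod a], so
   continuity is transferred through equality near [x]. *)
have E : {near nbhs x, (fun y : 'rV[R]_n => dxi (f (chart_inv a y)) *
    'd (f \o chart_inv a) y v) =1 (fun y => 'd (xi \o f \o chart_inv a) y v)}.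
  by move: Ux'; apply: filterS => y Uy; rewrite (hd y Uy).
exact: cvg_trans (near_eq_cvg E) cprod.
Qed.

(** [chart_at] depends on [p] alone, so both norms are computed in the same chart, where the
    gradient is multiplied by [d]. *)
Lemma grad_norm_comp f xi (d : R) p : C1 X f -> is_derive (f p) 1 xi d ->
  grad_norm X (xi \o f) p ^+ 2 = d ^+ 2 * grad_norm X f p ^+ 2.
Proof.
rewrite /grad_norm /chart_at; case: cid => a [aX ap] /= f1 dxi.
have [df _] := f1 a aX.
have cod : chart_cod a (chart_map a p) by exists p.
have -> : gradient_in X a (xi \o f) p = d *: gradient_in X a f p.
  rewrite /gradient_in scalemxAl; congr (_ *m _); apply/rowP => i; rewrite !mxE.
  have dxi' : is_derive ((f \o chart_inv a) (chart_map a p)) 1 xi d.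
    by rewrite /= chart_mapK.
  by have [_ ->] := diff_comp_real _ _ _ _ _ (df _ cod) dxi'.
rewrite linearZ/= -!scalemxAl -scalemxAr scalerA mxE -expr2 sqrtrM ?sqr_ge0//.
by rewrite exprMn sqr_sqrtr ?sqr_ge0.
Qed.

End manifold_calculus.

Section cutoff.
Context {R : realType}.
Implicit Types x y h : R.

Lemma is_derive_sqr_posr x :
  is_derive x (1 : R) (fun y => Num.max y 0 ^+ 2) (2 * Num.max x 0).
Proof.
suff hc : h^-1 *: (((fun y => Num.max y 0 ^+ 2) \o shift x) (h *: (1 : R)) -
    Num.max x 0 ^+ 2) @[h --> 0^'] --> 2 * Num.max x 0.
  by apply: DeriveDef; [apply/cvg_ex; eexists; exact: hc|exact/cvg_lim].
apply/cvgrPdist_le => e e0; near=> h.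
have h0 : h != 0 by near: h; exact: nbhs_dnbhs_neq.
have he : `|h| <= e by near: h; apply: dnbhs0_le.
apply: le_trans he; rewrite /= /shift /= scaler1.
set m1 := Num.max x 0; set m2 := Num.max (h + x) 0.
(* The error of the linear approximation is at most h^2 in all four sign cases, also when x and x +
   h lie on different sides of 0. *)
have key : `|2 * m1 * h - (m2 ^+ 2 - m1 ^+ 2)| <= h ^+ 2.
  rewrite distrC ler_norml /m1 /m2.
  by case: (leP x 0) => x0; case: (leP (h + x) 0) => hx0; apply/andP; split; nra.
rewrite -(ler_pM2r (_ : 0 < `|h|)) ?normr_gt0// -normrM -expr2 real_normK ?num_real//.
have -> // : (2 * m1 - h^-1 *: (m2 ^+ 2 - m1 ^+ 2)) * h =
    2 * m1 * h - (m2 ^+ 2 - m1 ^+ 2).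
by rewrite -[h^-1 *: _]/(h^-1 * _); field.
Unshelve. all: by end_near. Qed.

Lemma continuous_posr : continuous (fun x : R => Num.max x 0).
Proof. by move=> x; apply: continuous_max; [exact: cvg_id|exact: cvg_cst]. Qed.

(* A C^1 step from 0 to 1 whose derivative is the tent function of height 2 on [0, 1]. *)
Definition cutoff y : R :=
  2 * (Num.max y 0 ^+ 2 - 2 * Num.max (y - 2^-1) 0 ^+ 2 + Num.max (y - 1) 0 ^+ 2).

Definition tent y : R :=
  4 * (Num.max y 0 - 2 * Num.max (y - 2^-1) 0 + Num.max (y - 1) 0).

Lemma is_derive_cutoff y : is_derive y (1 : R) cutoff (tent y).
Proof.
have shiftd c : is_derive y (1 : R) (fun y => Num.max (y - c) 0 ^+ 2)
    (2 * Num.max (y - c) 0).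
  have d1 := is_derive_sqr_posr (y - c).
  have d2 : is_derive y (1 : R) (fun y : R => y - c) 1.
    by apply: is_derive_eq; rewrite subr0.
  have := @is_derive1_comp _ (fun y => Num.max y 0 ^+ 2) (fun y : R => y - c) y _ _ d1 d2.
  by rewrite mulr1.
have d0 := is_derive_sqr_posr y.
have d1 := shiftd 2^-1; have d2 := shiftd 1.
rewrite /cutoff /tent.
have -> : (fun y : R => 2 * (Num.max y 0 ^+ 2 - 2 * Num.max (y - 2^-1) 0 ^+ 2 +
   Num.max (y - 1) 0 ^+ 2)) = 2 *: ((fun y => Num.max y 0 ^+ 2) -
   2 *: (fun y => Num.max (y - 2^-1) 0 ^+ 2) + (fun y => Num.max (y - 1) 0 ^+ 2)).
  by apply/funext.
apply: is_derive_eq; rewrite /GRing.scale/=; ring.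
Qed.

Lemma continuous_tent : continuous tent.
Proof.
move=> y; rewrite /tent.
have sh c : {for y, continuous (fun y : R => Num.max (y - c) 0)}.
  apply: (@continuous_comp _ _ _ (fun y => y - c) (fun y => Num.max y 0)).
    by apply: cvgB; [exact: cvg_id|exact: cvg_cst].
  exact: continuous_posr.
apply: cvgM; first exact: cvg_cst.
apply: cvgD; last exact: sh.
apply: cvgB; first exact: continuous_posr.
by apply: cvgM; [exact: cvg_cst|exact: sh].
Qed.

Lemma cutoff_eq0 y : y <= 0 -> cutoff y = 0.
Proof. by move=> y0; rewrite /cutoff !max_r; lra. Qed.

Lemma cutoff_eq1 y : 1 <= y -> cutoff y = 1.
Proof. by move=> y1; rewrite /cutoff !max_l; lra. Qed.

Lemma cutoff_ge0 y : 0 <= cutoff y.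
Proof.
rewrite /cutoff; case: (leP y 0); case: (leP (y - 2^-1) 0);
  case: (leP (y - 1) 0); nra.
Qed.

Lemma cutoff_le1 y : cutoff y <= 1.
Proof.
rewrite /cutoff; case: (leP y 0); case: (leP (y - 2^-1) 0);
  case: (leP (y - 1) 0); nra.
Qed.

Lemma tent_eq0 y : y <= 0 \/ 1 <= y -> tent y = 0.
Proof.
by rewrite /tent; case: (leP y 0); case: (leP (y - 2^-1) 0);
  case: (leP (y - 1) 0) => h1 h2 h3 [h4|h4]; lra.
Qed.

Lemma tent_sqr_le y : tent y ^+ 2 <= 4.
Proof.
have : 0 <= tent y <= 2.
  by rewrite /tent; case: (leP y 0); case: (leP (y - 2^-1) 0);
    case: (leP (y - 1) 0) => h1 h2 h3; apply/andP; split; lra.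
by move=> /andP[]; nra.
Qed.

End cutoff.

(** * Entropy *)

Section superlevel_sets.
Context {d} {T : measurableType d} {R : realType}.
Variables (g : T -> R) (t : R).
Hypothesis mg : measurable_fun setT g.

Lemma measurable_superlevel_ge : measurable [set x | (t <= g x)%R].
Proof.
rewrite -[X in measurable X]setTI.
have -> : [set x | t <= g x] = g @^-1` `[t, +oo[%classic.
  by apply/seteqP; split => x /=; rewrite in_itv/= andbT.
exact: mg.
Qed.

Lemma measurable_superlevel_gt : measurable [set x | (t < g x)%R].
Proof.
rewrite -[X in measurable X]setTI.
have -> : [set x | t < g x] = g @^-1` `]t, +oo[%classic.
  by apply/seteqP; split => x /=; rewrite in_itv/= andbT.
exact: mg.
Qed.

End superlevel_sets.

Section entropy.
Context {d} {T : measurableType d} {R : realType}.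
Implicit Types (F G : T -> R).

Lemma le_integral_meas (mu : {measure set T -> \bar R}) (f g : T -> \bar R) :
  measurable_fun setT f -> measurable_fun setT g -> (forall x, (f x <= g x)%E) ->
  (\int[mu]_x f x <= \int[mu]_x g x)%E.
Proof.
move=> mf mg fg; rewrite integralE [leRHS]integralE leeB//.
- apply: ge0_le_integral => //; [exact: measurable_funepos|exact: measurable_funepos|].
  by move=> x _; apply: (@funepos_le _ _ setT) => //; rewrite ?inE.
- apply: ge0_le_integral => //; [exact: measurable_funeneg|exact: measurable_funeneg|].
  by move=> x _; apply: (@funeneg_le _ _ setT) => //; rewrite ?inE.
Qed.

Variable mu : probability T R.

Lemma integral_affine F (a b : R) : mu.-integrable setT (EFin \o F) ->
  mu.-integrable setT (fun x => (a * F x + b)%:E) /\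
  (\int[mu]_x (a * F x + b)%:E = (a * fine (\int[mu]_x (F x)%:E) + b)%:E)%E.
Proof.
move=> iF.
have iaF : mu.-integrable setT (fun x => a%:E * (F x)%:E)%E by exact: integrableZl.
have ib : mu.-integrable setT (fun x : T => b%:E).
  by apply: (finite_measure_integrable_cst mu b).
split; first exact: (integrableD measurableT iaF ib).
transitivity (\int[mu]_x (a%:E * (F x)%:E + b%:E))%E; first by [].
rewrite integralD// integralZl// integral_cst//= probability_setT mule1 EFinD EFinM fineK//.
exact: integrable_fin_num.
Qed.

Lemma integrable_of_ge0 F : measurable_fun setT F -> (forall x, 0 <= F x) ->
  (\int[mu]_x (F x)%:E)%E != +oo%E -> mu.-integrable setT (EFin \o F).
Proof.
move=> mF F0 Fy; apply/integrableP; split; first exact/measurable_EFinP.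
rewrite (eq_integral (fun x => (F x)%:E)); first by rewrite lt_neqAle Fy leey.
by move=> x _ /=; rewrite ger0_norm.
Qed.

Lemma measurable_xlnx F (m : R) : measurable_fun setT F ->
  measurable_fun setT (fun x => (F x * ln (F x / m))%:E).
Proof.
move=> mF; apply/measurable_EFinP/measurable_funM => //.
apply: (measurableT_comp (@measurable_ln R)).
exact: measurable_funM.
Qed.

Lemma xlnx_ge (x y : R) : 0 <= x -> 0 < y -> x - y <= x * ln (x / y).
Proof.
rewrite le_eqVlt => /predU1P[<-|x0] y0; first by rewrite !mul0r; lra.
rewrite [leLHS](_ : _ = x * (1 - (x / y)^-1)); last by field; rewrite !gt_eqF.
by rewrite ler_pM2l// ln_ge_subr1V// divr_gt0.
Qed.

(** Integrate x ln (x / m) >= x - m, with m the mean of [F]: the right-hand side has integral 0. If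
    m = 0, the convention 1/0 = 0 makes the integrand vanish. *)
Lemma Ent_ge0 F : measurable_fun setT F -> (forall x, 0 <= F x) -> (0 <= Ent mu F)%E.
Proof.
move=> mF F0; rewrite /Ent; case: ifPn => // Fy.
have iF := integrable_of_ge0 _ mF F0 Fy; set m := fine _.
have m0 : 0 <= m by apply/fine_ge0/integral_ge0 => x _; rewrite lee_fin.
have := m0; rewrite le_eqVlt => /predU1P[<-|{}m0].
  by rewrite integral0_eq// => x _; rewrite invr0 mulr0 ln0// mulr0.
have [iV eV] := integral_affine _ 1 (- m) iF.
rewrite [leLHS](_ : _ = (\int[mu]_x (1 * F x + - m)%:E)%E); last first.
  by rewrite eV mul1r subrr.
apply: le_integral_meas; first by case/integrableP: iV.
  exact: measurable_xlnx.
by move=> x; rewrite lee_fin mul1r xlnx_ge.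
Qed.

(* The variational formula for the entropy, tested on the density
   equal to 1 + 1 / (2 mu(A)) on A and to 1 on Om \ A. *)
Lemma Ent_ge_capl G (A Om : set T) : measurable A -> measurable Om ->
  measurable_fun setT G -> (forall x, 0 <= G x <= 1) ->
  (forall x, A x -> G x = 1) -> (forall x, ~ Om x -> G x = 0) ->
  (mu Om <= (2^-1)%:E)%E -> ((capl (fine (mu A)))%:E <= Ent mu G)%E.
Proof.
move=> mA mOm mG G01 GA GOm Om2; have G0 x : 0 <= G x by have /andP[] := G01 x.
have muA := fin_num_measure mu A mA; set a := fine _.
have a0 : 0 <= a by apply/fine_ge0.
have := a0; rewrite le_eqVlt => /predU1P[<-|{}a0].
  by rewrite capl0; exact: Ent_ge0.
rewrite /Ent; case: ifPn => [_|Gy]; first by rewrite leey.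
have iG := integrable_of_ge0 _ mG G0 Gy; set m := fine _.
have mE : (\int[mu]_x (G x)%:E = m%:E)%E by rewrite fineK// integrable_fin_num.
have m0 : 0 < m.
  rewrite (lt_le_trans a0)// -lee_fin -mE /a fineK//.
  rewrite -[leLHS](_ : (\int[mu]_x (\1_A x)%:E = mu A)%E); last by rewrite integral_indic// setIT.
  apply: le_integral_meas.
  - exact/measurable_EFinP/measurable_indic.
  - exact/measurable_EFinP.
  - move=> x; rewrite lee_fin indicE; case: (boolP (x \in A)) => //=.
    by rewrite inE => /GA ->.
pose L := ln (1 + (2 * a)^-1); set b := fine (mu Om).
have muOm : mu Om = b%:E by rewrite fineK// fin_num_measure.
have b2 : b <= 2^-1 by rewrite -lee_fin -muOm.
have eA : (\int[mu]_x (\1_A x)%:E = a%:E)%E by rewrite integral_indic// setIT fineK.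
have eO : (\int[mu]_x (\1_Om x)%:E = b%:E)%E by rewrite integral_indic// setIT.
(* The minorant of G ln (G / m) is G + k 1_A - m 1_Om. On [A] it amounts to ln y <= y - 1 at y = m
   (1 + 1/(2a)); on the rest of [Om] it is [xlnx_ge]. Its integral m + a L - m/2 - m b is at least a
   L because b <= 1/2. *)
pose k := L - m / (2 * a).
have iA : mu.-integrable setT (fun x => k%:E * (\1_A x)%:E)%E.
  by apply: integrableZl => //; exact: integrable_indic.
have iO : mu.-integrable setT (fun x => (- m)%:E * (\1_Om x)%:E)%E.
  by apply: integrableZl => //; exact: integrable_indic.
have iAO := integrableD measurableT iA iO.
have iB := integrableD measurableT iG iAO.
apply: (@le_trans _ _ (\int[mu]_x ((G x)%:E + (k%:E * (\1_A x)%:E + (- m)%:E * (\1_Om x)%:E)))%E).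
  rewrite integralD// integralD// !integralZl//; [|exact: integrable_indic|exact: integrable_indic].
  rewrite mE eA eO -!EFinM -!EFinD lee_fin.
  rewrite /capl -/L /k.
  have -> : (L - m / (2 * a)) * a = a * L - m / 2 by field; rewrite gt_eqF.
  have : m * b <= m * 2^-1 by rewrite ler_pM2l.
  lra.
apply: le_integral_meas; first by case/integrableP: iB.
  exact: measurable_xlnx.
move=> x; rewrite -!EFinM -!EFinD lee_fin !indicE.
have [xA|xA] := boolP (x \in A).
  move: xA; rewrite inE => /GA Gx.
  have -> : (x \in Om) by rewrite inE; apply/not_notP => /GOm; rewrite Gx => /eqP; rewrite oner_eq0.
  rewrite Gx !mulr1 !mul1r /k /L.
  have h : 0 < 1 + (2 * a)^-1 by rewrite addr_gt0// invr_gt0 mulr_gt0.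
  have := @ln_le_subr1 R (m * (1 + (2 * a)^-1)); rewrite mulr_gt0// => /(_ isT).
  rewrite lnM ?posrE// lnV ?posrE//.
  have -> : m * (1 + (2 * a)^-1) = m + m / (2 * a) by ring.
  lra.
rewrite mulr0 add0r.
have [xO|xO] := boolP (x \in Om); last first.
  by rewrite GOm ?mulr0 ?mul0r ?addr0//; move: xO; rewrite notin_setE.
by rewrite mulr1 xlnx_ge.
Qed.

(** With m the mean of [F], F ln (F / m) is the sum of F ln (F / t) - F + t and (1 + ln (t / m)) F -
    t. The latter integrates to m + m ln (t / m) - t <= 0. The majorant is extended-valued so that
    it may be a series. *)
Lemma Ent_le F (H : T -> \bar R) (t : R) : 0 < t ->
  measurable_fun setT F -> (forall x, 0 <= F x) -> (\int[mu]_x (F x)%:E != +oo)%E ->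
  measurable_fun setT H -> (forall x, 0 <= H x)%E ->
  (forall x, (F x * ln (F x / t) - F x + t)%:E <= H x)%E ->
  (Ent mu F <= \int[mu]_x H x)%E.
Proof.
move=> t0 mF F0 Fy mH H0 FH.
have [->|Hy] := eqVneq (\int[mu]_x H x)%E +oo%E; first by rewrite leey.
have iH : mu.-integrable setT H.
  apply/integrableP; split => //; rewrite (eq_integral H); first by rewrite lt_neqAle Hy leey.
  by move=> x _; rewrite gee0_abs.
rewrite /Ent (negbTE Fy).
have iF := integrable_of_ge0 _ mF F0 Fy; set m := fine _.
have m0 : 0 <= m by apply/fine_ge0/integral_ge0 => x _; rewrite lee_fin.
have := m0; rewrite le_eqVlt => /predU1P[<-|{}m0].
  rewrite integral0_eq ?integral_ge0// => x _.
  by rewrite invr0 mulr0 ln0// mulr0.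
have [iV eV] := integral_affine _ (1 + ln (t / m)) (- t) iF.
apply: (@le_trans _ _ (\int[mu]_x (H x + ((1 + ln (t / m)) * F x + - t)%:E))%E); last first.
  rewrite integralD// eV -/m geeDl// lee_fin.
  have := @ln_le_subr1 R (t / m); rewrite divr_gt0// => /(_ isT)/(ler_wpM2r (ltW m0)).
  rewrite mulrBl divfK ?gt_eqF//; lra.
apply: le_integral_meas; first exact: measurable_xlnx.
  by case/integrableP: (integrableD measurableT iH iV).
move=> x; have := F0 x; rewrite le_eqVlt => /predU1P[Fx0|Fx].
  move: (FH x); rewrite -Fx0 !(mul0r, mulr0, sub0r, add0r, oppr0) => h.
  by rewrite EFinN leeBrDr// add0e.
have -> : F x * ln (F x / m) = (F x * ln (F x / t) - F x + t) +
    ((1 + ln (t / m)) * F x + - t).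
  rewrite !ln_div ?posrE//; ring.
by rewrite EFinD leeD2r.
Qed.

End entropy.

(** * From the weak inequality to level sets *)

Section level_sets.
Context {R : realType} {n : nat} {M : ptopologicalType}.
Variable X : riemannian_manifold R n M.
Variables (mu : probability (borel M) R) (nu : {measure set (borel M) -> \bar R}).
Implicit Types (f : M -> R).

Lemma continuous_measurable_borel f : continuous f ->
  measurable_fun setT (f : borel M -> R).
Proof.
move=> /continuousP cf; apply: (measurability _ (RGenOpens.measurableE R)) => _ [_ [a [b ->]] <-].
rewrite setTI; apply: sub_sigma_algebra; apply: cf; exact: interval_open.
Qed.

Lemma Osc_sqr_le1 (G : borel M -> R) : (forall x, 0 <= G x <= 1) ->
  (Osc mu G ^+ 2 <= 1)%E.
Proof.
move=> G01.
have muT : (0 < mu [set: borel M])%E by rewrite probability_setT.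
have s1 : (ess_sup mu (EFin \o G) <= 1)%E.
  by apply/ess_supP/nearW => x /=; rewrite lee_fin; have /andP[] := G01 x.
have s0 : (0 <= ess_sup mu (EFin \o G))%E.
  by apply: ess_sup_ger => // x; rewrite lee_fin; have /andP[] := G01 x.
have i0 : (0 <= ess_inf mu (EFin \o G))%E.
  by apply/ess_infP/nearW => x /=; rewrite lee_fin; have /andP[] := G01 x.
have i1 : (ess_inf mu (EFin \o G) <= 1)%E.
  rewrite -[leRHS](ess_inf_cst 1%E muT); apply: le_ess_inf; apply: nearW => x /=.
  by rewrite lee_fin; have /andP[] := G01 x.
rewrite /Osc; move: s1 s0 i0 i1.
case: (ess_sup _ _) => [a| |]//; case: (ess_inf _ _) => [b| |]//.
rewrite !lee_fin => a1 a0 b0 b1.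
by nra.
Qed.

(* tau^2 / 16 times the squared gradient norm of the cutoff of f between tau / 2 and tau. *)
Definition layer (f : M -> R) (tau : R) (x : M) : R :=
  tent (2 / tau * f x - 1) ^+ 2 / 4 * grad_norm X f x ^+ 2.

Lemma layer_ge0 f tau x : 0 <= layer f tau x.
Proof. by rewrite /layer mulr_ge0 ?divr_ge0 ?sqr_ge0. Qed.

Lemma layer_le f tau x : layer f tau x <= grad_norm X f x ^+ 2.
Proof.
rewrite /layer ler_piMl ?sqr_ge0// ler_pdivrMr// mul1r; exact: tent_sqr_le.
Qed.

Lemma layer_eq0 f tau x : 0 < tau -> f x <= tau / 2 \/ tau <= f x -> layer f tau x = 0.
Proof.
move=> t0 h; rewrite /layer tent_eq0; first by rewrite expr0n/= !mul0r.
case: h => h; [left|right].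
  by rewrite subr_le0 mulrAC ler_pdivrMr// mul1r; lra.
by rewrite lerBrDr mulrAC ler_pdivlMr//; lra.
Qed.

Variable h : R -> R.
Hypothesis wls : weak_log_sobolev X mu nu h.

(* Testing the weak inequality, with s half of the left-hand side, on a
   cutoff of f equal to 1 on [f >= tau] and vanishing on [f <= tau / 2]. *)
Lemma capl_le_layer f (tau : R) : C1 X f -> 0 < tau ->
  (mu [set x | (0 < f x)%R] <= (2^-1)%:E)%E ->
  let u := capl (fine (mu [set x | (tau <= f x)%R])) in 0 < u ->
  ((tau ^+ 2 * u / h (u / 2))%:E <= 32%:E * \int[nu]_x (layer f tau x)%:E)%E.
Proof.
move=> f1 t0 muf u u0; have [h0 _ ws] := wls.
pose xi (y : R) := cutoff (2 / tau * y - 1).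
pose dxi (y : R) := tent (2 / tau * y - 1) * (2 / tau).
have aff y : is_derive y (1 : R) (fun y : R => 2 / tau * y - 1) (2 / tau).
  by apply: is_derive_eq; rewrite /GRing.scale/= subr0 mulr1.
have dxiP (y : R) : is_derive y (1 : R) xi (dxi y).
  have := @is_derive1_comp _ cutoff (fun y : R => 2 / tau * y - 1) y _ _
    (is_derive_cutoff (2 / tau * y - 1)) (aff y).
  by [].
have cdxi : continuous dxi.
  move=> y; apply: cvgM; last exact: cvg_cst.
  apply: (@continuous_comp _ _ _ (fun y : R => 2 / tau * y - 1) tent).
    apply: cvgB; last exact: cvg_cst.
    by apply: cvgM; [exact: cvg_cst|exact: cvg_id].
  exact: continuous_tent.
have xi1 : C1 X (xi \o f) by exact: C1_comp dxiP cdxi.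
have bxi : bounded_fun (xi \o f).
  exists 1; split; first exact: num_real.
  move=> b b1 x _ /=; rewrite ger0_norm ?cutoff_ge0//.
  by rewrite (le_trans (cutoff_le1 _))// ltW.
have mf := continuous_measurable_borel _ (C1_continuous _ _ f1).
have mxi := continuous_measurable_borel _ (C1_continuous _ _ xi1).
have E1 : (u%:E <= Ent mu (fun x => ((xi \o f) x ^+ 2)%R))%E.
  apply: (@Ent_ge_capl _ _ _ mu _ [set x | tau <= f x] [set x | 0 < f x]) => //.
  - exact: measurable_superlevel_ge.
  - exact: measurable_superlevel_gt.
  - exact: measurable_funX.
  - move=> x /=; have := cutoff_ge0 (2 / tau * f x - 1).
    have := cutoff_le1 (2 / tau * f x - 1); rewrite /xi => *.
    by rewrite sqr_ge0/= expr_le1.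
  - move=> x /= fx; rewrite /xi cutoff_eq1 ?expr1n//.
    by rewrite lerBrDr mulrAC ler_pdivlMr//; lra.
  - move=> x /= /negP; rewrite -leNgt => fx; rewrite /xi cutoff_eq0 ?expr0n//.
    by rewrite subr_le0 mulrAC ler_pdivrMr// mul1r; lra.
have u2 : 0 < u / 2 by rewrite divr_gt0.
have {}E1 := le_trans E1 (ws _ xi1 bxi _ u2).
have Osc1 : (Osc mu (xi \o f) ^+ 2 <= 1)%E.
  by apply: Osc_sqr_le1 => x; rewrite /= cutoff_ge0 cutoff_le1.
have c0 : 0 < 16 / tau ^+ 2 by rewrite divr_gt0// exprn_gt0.
(* The factor 16 is 4 from the slope 2 / tau squared, times 4 from the normalization of [layer]. *)
have gE : (\int[nu]_x (grad_norm X (xi \o f) x ^+ 2)%:E =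
    (16 / tau ^+ 2)%:E * \int[nu]_x (layer f tau x)%:E)%E.
  rewrite -integralZl_nomeas//; last by move=> x; rewrite lee_fin layer_ge0.
  apply: eq_integral => x _; rewrite (grad_norm_comp _ _ _ _ _ f1 (dxiP (f x))).
  rewrite -EFinM; congr EFin; rewrite /dxi /layer; field; exact: lt0r_neq0.
have {E1} : (u%:E <= (h (u / 2))%:E * ((16 / tau ^+ 2)%:E *
    \int[nu]_x (layer f tau x)%:E) + (u / 2)%:E)%E.
  rewrite -gE (le_trans E1)// leeD2l// -[leRHS]mule1 lee_pmul2l// lte_fin.
rewrite -leeBlDr// -EFinB => E2.
have hu := h0 _ u2.
have k0 : 0 < h (u / 2) * (16 / tau ^+ 2) by rewrite mulr_gt0.
move: E2; rewrite muleA -EFinM -lee_pdivrMl// -EFinM => E2.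
(* Absorbing the oscillation term leaves u - u/2 = u/2, which turns 16 into 32. *)
have -> : tau ^+ 2 * u / h (u / 2) =
    32 * ((h (u / 2) * (16 / tau ^+ 2))^-1 * (u - u / 2)).
  by field; rewrite !gt_eqF.
by rewrite EFinM lee_pmul2l// lte_fin.
Qed.

End level_sets.

(** * Summation over the dyadic levels *)

Section level_sum.
Context {R : realType} {n : nat} {M : ptopologicalType}.
Variable X : riemannian_manifold R n M.
Variables (mu : probability (borel M) R) (nu : {measure set (borel M) -> \bar R}).
Variables (h : R -> R) (c q : R).
Hypothesis wls : weak_log_sobolev X mu nu h.
Hypotheses (c0 : 0 < c) (c2 : c <= 2^-1) (hq : 2^-1 <= q < 1).
Hypothesis h_int : (\int[lebesgue_measure]_(t in `]0%R, 2^-1%R[)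
     (h (c * t) `^ (q / (1 - q)))%:E < +oo)%E.

Lemma level_sum_bounded : exists2 C : R, 0 < C & forall f : M -> R, C1 X f ->
  (mu [set x | (0 < f x)%R] <= (2^-1)%:E)%E ->
  (\int[nu]_x (grad_norm X f x ^+ 2)%:E <= 1)%E ->
  forall K : nat, \sum_(k < K) (4 ^+ k) `^ q *
    capl (fine (mu [set x | (2 ^+ k <= f x)%R])) <= C.
Proof.
have [h0 hdec _] := wls; have /andP[hq2 q1] := hq.
have q0 : 0 < q by apply: lt_le_trans hq2; rewrite invr_gt0.
have := h_int; set I := (\int[_]_(_ in _) _)%E => Ioo.
have I0 : (0 <= I)%E by apply: integral_ge0 => x _; rewrite lee_fin powR_ge0.
have Ifin : I \is a fin_num by rewrite ge0_fin_numE.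
(* Adding 1 gives a positive bound to normalize by in Hoelder's inequality. *)
have Y0 : 0 < fine I + 1 by rewrite ltr_wpDl// fine_ge0.
exists (2 * (32 `^ q * (fine I + 1) `^ (1 - q))).
  by rewrite !mulr_gt0 ?powR_gt0.
move=> f f1 muf fE K.
have mf := continuous_measurable_borel _ (C1_continuous _ _ f1).
have mA (t : R) : measurable ([set x | (t <= f x)%R] : set (borel M)).
  exact: measurable_superlevel_ge.
pose a k := fine (mu [set x | (2 ^+ k <= f x)%R]).
have a0 k : 0 <= a k by exact/fine_ge0.
have pow_le j k : (j <= k)%N -> 2 ^+ j <= 2 ^+ k :> R.
  by move=> jk; apply: ler_weXn2l => //; rewrite ler1n.
have aS k : a k.+1 <= a k.
  apply: fine_le; [exact: fin_num_measure|exact: fin_num_measure|].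
  apply: le_measure; [by rewrite inE|by rewrite inE|].
  by move=> x /=; apply: le_trans; exact: pow_le.
(* Truncating at [K] makes the boundary term of the Abel summation vanish and keeps the sequence
   nonincreasing. *)
pose u k := if (k < K)%N then capl (a k) else 0.
have u0 k : 0 <= u k by rewrite /u; case: ifP => // _; exact: capl_ge0.
have uS k : u k.+1 <= u k.
  rewrite /u; case: ifPn => [k1|_]; last by case: ifPn => // _; exact: capl_ge0.
  by rewrite (ltnW k1) capl_homo.
have uK : u K = 0 by rewrite /u ltnn.
have u2 : u 0%N <= 2^-1.
  by rewrite /u; case: ifPn => _; [exact: capl_le_half|rewrite invr_ge0].
have H0 k : 0 < u k -> 0 < h (u k / 2) by move=> uk; apply: h0; rewrite divr_gt0.
have hX : \sum_(k < K) 4 ^+ k * u k / h (u k / 2) <= 32.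
  rewrite -lee_fin -sumEFin.
  apply: (@le_trans _ _ (\sum_(k < K) 32%:E * \int[nu]_x (layer X f (2 ^+ k) x)%:E)%E).
    apply: lee_sum => k _; rewrite /u ltn_ord.
    have := capl_ge0 _ (a0 k); rewrite le_eqVlt => /predU1P[<-|ck].
      rewrite mulr0 mul0r mule_ge0// integral_ge0// => x _.
      by rewrite lee_fin layer_ge0.
    have -> : (4 : R) ^+ k = (2 ^+ k) ^+ 2.
      by rewrite exprAC (_ : (2 : R) ^+ 2 = 4)//; ring.
    by apply: (@capl_le_layer _ _ _ _ _ _ _ wls) => //; exact: exprn_gt0.
  rewrite -ge0_sume_distrr; last first.
    by move=> k _; apply: integral_ge0 => x _; rewrite lee_fin layer_ge0.
  rewrite -[leRHS]mule1 lee_pmul2l ?lte_fin//.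
  apply: le_trans fE; apply: (@integral_sum_disjoint_le _ _ _ nu K
     (fun k x => (layer X f (2 ^+ k) x)%:E)) => //.
  - by move=> k x; rewrite lee_fin layer_ge0.
  - by move=> k x; rewrite lee_fin layer_le.
  - move=> x j k jk.
    (* Layer j lives on 2^(j-1) < f < 2^j. If f < 2^j, then f <= 2^(k-1), below layer k. *)
    have [jx|xj] := leP (2 ^+ j) (f x).
      by left; rewrite layer_eq0//; right.
    right; rewrite layer_eq0//; left.
    rewrite ler_pdivlMr// (le_trans _ (pow_le _ _ jk))// exprS mulrC ler_pM2l// ltW//.
have hY : \sum_(k < K) (u k - u k.+1) * h (u k / 2) `^ (q / (1 - q)) <= fine I + 1.
  have r0 : 0 <= q / (1 - q) by rewrite divr_ge0 ?subr_ge0// ltW.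
  have := riemann_sum_le h c _ u K c0 c2 r0 h0 hdec u0 uS u2.
  by rewrite -/I -(fineK Ifin) lee_fin => /le_trans; apply; rewrite lerDl.
have := dyadic_sum_le q 32 _ K u (fun k => h (u k / 2)) hq (ltr0n _ _) Y0
  u0 uS uK H0 hX hY.
by under eq_bigr do rewrite /u ltn_ord.
Qed.

End level_sum.

(** * Dyadic majorant of the entropy density *)

Section dyadic_weight.
Context {R : realType}.
Implicit Types (x y p q : R).

Lemma powR2_le4 p : p <= 2 -> (2 : R) `^ p <= 4.
Proof.
move=> p2; rewrite (@le_trans _ _ ((2 : R) `^ 2%:R))//.
  by rewrite ler_powR// ler1n.
by rewrite powR_mulrn// -natrX.
Qed.

Lemma powRD_le x y p : 0 <= x -> 0 <= y -> 0 <= p <= 2 ->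
  (x + y) `^ p <= 4 * (x `^ p + y `^ p).
Proof.
move=> x0 y0 /andP[p0 p2].
wlog xy : x y x0 y0 / x <= y.
  move=> wl; have [/wl|/ltW/wl] := leP x y; first exact.
  by rewrite addrC [_ `^ p + _]addrC; apply.
rewrite (@le_trans _ _ ((2 * y) `^ p))//.
  by rewrite ge0_ler_powR ?nnegrE ?mulr_ge0 ?addr_ge0//; lra.
rewrite powRM// (@le_trans _ _ (4 * y `^ p))//.
  by rewrite ler_wpM2r ?powR_ge0// powR2_le4.
by rewrite ler_pM2l// lerDr powR_ge0.
Qed.

(** Comparing y^p with 1 and y^2 gives |y^p - 1| <= 3 |y - 1|. Since |y - 1| <= 1, its square is at
    most its p-th power. *)
Lemma powR_sub1_le y p : 0 <= y -> y <= 2 -> 1 <= p <= 2 ->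
  (y `^ p - 1) ^+ 2 <= 9 * `|y - 1| `^ p.
Proof.
move=> y0 y2 /andP[p1 p2].
have h1 : (y `^ p - 1) ^+ 2 <= 9 * `|y - 1| `^ 2%:R.
  rewrite powR_mulrn// real_normK ?num_real//.
  have [y1|y1] := leP 1 y.
    have : 1 <= y `^ p.
      by rewrite -[leLHS](powRr0 y) ler_powR//; lra.
    have : y `^ p <= y ^+ 2 by rewrite -powR_mulrn// ler_powR.
    move=> Y2 Y1; have : y `^ p - 1 <= 3 * (y - 1) by nra.
    move=> ?; nra.
  move: y0; rewrite le_eqVlt => /predU1P[<-|y0].
    by rewrite powR0 ?gt_eqF//; lra.
  have y01 : 0 < y <= 1 by rewrite y0 ltW.
  have : y `^ p <= 1 by rewrite -[leRHS](powRr0 y) ger_powR//; lra.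
  have : y ^+ 2 <= y `^ p by rewrite -powR_mulrn ?(ltW y0)// ger_powR.
  move=> Y2 Y1; have : 1 - y `^ p <= 2 * (1 - y) by nra.
  move=> ?; nra.
apply: (le_trans h1); rewrite ler_pM2l//.
have [->|yN1] := eqVneq y 1; first by rewrite subrr normr0 !powR0 ?gt_eqF//; lra.
rewrite ger_powR// normr_gt0 subr_eq0 yN1/= ler_norml; lra.
Qed.

(** By homogeneity put Y = (x / T)^p; then ln Y <= Y - 1 gives Y ln Y - Y + 1 <= (Y - 1)^2. *)
Lemma xlnx_le_powR x T p : 0 <= x -> 0 < T -> x <= 2 * T -> 1 <= p <= 2 ->
  x `^ p * ln (x `^ p / T `^ p) - x `^ p + T `^ p <= 9 * `|x - T| `^ p.
Proof.
move=> x0 T0 xT p12.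
have t0 : 0 < T `^ p by rewrite powR_gt0.
have y0 : 0 <= x / T by rewrite divr_ge0// ltW.
have xE : x `^ p = T `^ p * (x / T) `^ p.
  by rewrite -powRM ?(ltW T0)// mulrC divfK ?gt_eqF.
have -> : `|x - T| = T * `|x / T - 1|.
  rewrite -[RHS](_ : `|T| * `|x / T - 1| = _); last by rewrite (gtr0_norm T0).
  by rewrite -normrM; congr `|_|; field; rewrite gt_eqF.
rewrite powRM ?(ltW T0)// mulrCA.
apply: (@le_trans _ _ (T `^ p * ((x / T) `^ p - 1) ^+ 2)); last first.
  by rewrite ler_pM2l// powR_sub1_le// ler_pdivrMr.
rewrite xE; set Y := (x / T) `^ p; set t := T `^ p.
have Y0 : 0 <= Y by exact: powR_ge0.
have -> : t * Y / t = Y by rewrite mulrC mulKf// gt_eqF.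
have : Y * ln Y <= Y * (Y - 1).
  have := Y0; rewrite le_eqVlt => /predU1P[<-|{}Y0]; first by rewrite !mul0r.
  by rewrite ler_pM2l// ln_le_subr1.
move=> /(ler_wpM2l (ltW t0)); rewrite -/t; lra.
Qed.

Lemma dyadic_itv y : 1 <= y -> exists k, 2 ^+ k <= y < 2 ^+ k.+1.
Proof.
move=> y1; have y0 : 0 <= y by lra.
have /andP[t1 t2] := truncn_itv y0.
have n0 : (0 < Num.truncn y)%N by rewrite truncn_gt0.
have /andP[k1 k2] := trunc_log_bounds (isT : (1 < 2)%N) n0.
exists (trunc_log 2 (Num.truncn y)); apply/andP; split.
  by rewrite (le_trans _ t1)// -natrX ler_nat.
by rewrite (lt_le_trans t2)// -natrX ler_nat.
Qed.

(** The size of y^(2q) (1 + log y) at y = 2^k. The 16 absorbs the constants in comparing x^(2q) with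
    (m + b)^(2q), and makes the logarithm at least 1. *)
Definition log_weight q (k : nat) : R := (4 ^+ k) `^ q * ln (16 * (4 ^+ k) `^ q).

Definition dyadic_weight q y : \bar R :=
  (\sum_(0 <= k <oo) (log_weight q k * (2 ^+ k <= y)%R%:R)%:E)%E.

Lemma powR4X_ge1 q k : 0 <= q -> 1 <= (4 ^+ k : R) `^ q.
Proof.
move=> q0; rewrite -[leLHS](powRr0 (4 ^+ k)) ler_powR// exprn_ege1// ler1n//.
Qed.

Lemma ln16_ge1 : 1 <= ln (16 : R).
Proof.
rewrite (_ : 16 = 4 * 4); last by ring.
by rewrite lnM ?posrE//; have := @ln_ge_subr1V R 4; lra.
Qed.

Lemma powR_le_log_weight q y k : 2^-1 <= q < 1 -> 0 <= y -> y < 2 ^+ k.+1 ->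
  y `^ (2 * q) <= 4 * (4 ^+ k) `^ q.
Proof.
move=> /andP[hq q1] y0 yk; have q0 : 0 <= q by lra.
rewrite (@le_trans _ _ ((2 ^+ k.+1) `^ (2 * q)))//.
  by rewrite ge0_ler_powR ?nnegrE ?exprn_ge0 ?(ltW yk)//; lra.
rewrite powRrM powR_mulrn ?exprn_ge0// exprAC.
rewrite (_ : (2 : R) ^+ 2 = 4); last by ring.
rewrite exprS powRM ?exprn_ge0// ler_wpM2r ?powR_ge0//.
rewrite -[leRHS]powRr1// ler_powR ?ler1n//; exact: ltW.
Qed.

Lemma log_weight_ge0 q k : 0 <= q -> 0 <= log_weight q k.
Proof.
move=> q0; have h := powR4X_ge1 q k q0.
rewrite /log_weight mulr_ge0 ?powR_ge0// ln_ge0//; lra.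
Qed.

Lemma log_weight_ge q k : 0 <= q -> (4 ^+ k) `^ q <= log_weight q k.
Proof.
move=> q0; have h := powR4X_ge1 q k q0; rewrite /log_weight ler_peMr ?powR_ge0//.
rewrite (le_trans ln16_ge1)// ler_ln ?posrE//; lra.
Qed.

Lemma dyadic_weight_ge0 q y : 0 <= q -> (0 <= dyadic_weight q y)%E.
Proof.
by move=> q0; apply: nneseries_ge0 => k _ _; rewrite lee_fin mulr_ge0 ?log_weight_ge0.
Qed.

Lemma dyadic_weight_ge q y k : 0 <= q -> 2 ^+ k <= y ->
  ((log_weight q k)%:E <= dyadic_weight q y)%E.
Proof.
move=> q0 ky; have t0 j : (0 <= (log_weight q j * (2 ^+ j <= y)%R%:R)%:E)%E.
  by rewrite lee_fin mulr_ge0 ?log_weight_ge0.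
apply: le_trans (nneseries_lim_ge k.+1 _); last by move=> j _ _.
by rewrite big_nat_recr//= ky mulr1 leeDr// sume_ge0.
Qed.

End dyadic_weight.

(** * Pointwise bounds by the dyadic weights *)

Section pointwise_bounds.
Context {R : realType}.
Variable q : R.
Hypothesis hq : 2^-1 <= q < 1.
Implicit Types (x m b z : R).

(** Here and below [r] stands for a finite value of the sum of the dyadic weights of z and -z; all
    that is used is that it dominates every weight whose level is reached. *)
Lemma abs_powR_le z (r : R) :
  (forall k : nat, 2 ^+ k <= z -> log_weight q k <= r) ->
  (forall k : nat, 2 ^+ k <= - z -> log_weight q k <= r) -> 0 <= r ->
  `|z| `^ (2 * q) <= 1 + 4 * r.
Proof.
have /andP[q2 q1] := hq; have q0 : 0 <= q by lra.
move=> hp hn r0; have [z1|z1] := leP 1 `|z|; last first.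
  rewrite (@le_trans _ _ (1 `^ (2 * q)))//; last by rewrite powR1; lra.
  rewrite ge0_ler_powR ?nnegrE//; first by lra.
  exact: ltW.
have [k /andP[k1 k2]] := dyadic_itv _ z1.
have h := powR_le_log_weight q `|z| k hq (normr_ge0 _) k2.
have : log_weight q k <= r.
  by move: k1; case: (ger0P z) => _ ?; [exact: hp|exact: hn].
have := log_weight_ge q k q0; lra.
Qed.

Lemma shifted_powR_le x m b (r : R) : 0 <= x -> 0 <= m -> 0 < b ->
  (forall k : nat, 2 ^+ k <= (x - m) / b -> log_weight q k <= r) ->
  (forall k : nat, 2 ^+ k <= - ((x - m) / b) -> log_weight q k <= r) -> 0 <= r ->
  x `^ (2 * q) <= 4 * (m `^ (2 * q) + b `^ (2 * q) * (1 + 4 * r)).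
Proof.
have /andP[q2 q1] := hq.
move=> x0 m0 b0 hp hn r0; have zr := abs_powR_le _ _ hp hn r0.
have p12 : 0 <= 2 * q <= 2 by lra.
apply: (@le_trans _ _ ((m + b * `|(x - m) / b|) `^ (2 * q))).
  rewrite ge0_ler_powR ?nnegrE ?addr_ge0 ?mulr_ge0 ?(ltW b0)//; first by lra.
  rewrite normrM normfV (gtr0_norm b0) mulrC divfK ?gt_eqF//.
  by have := ler_norm (x - m); lra.
apply: le_trans (powRD_le _ _ _ _ _ p12) _ => //; first by rewrite mulr_ge0 ?(ltW b0).
rewrite ler_pM2l// lerD2l powRM ?(ltW b0)//.
by rewrite ler_pM2l// powR_gt0.
Qed.

(* Below 2 (m + b) the integrand is quadratic around its minimum; above, x is
   comparable to x - m and the logarithm is at most that of the dyadic weight. *)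
Lemma entropy_density_le x m b (r : R) : 0 <= x -> 0 <= m -> 0 < b ->
  (forall k : nat, 2 ^+ k <= (x - m) / b -> log_weight q k <= r) ->
  (forall k : nat, 2 ^+ k <= - ((x - m) / b) -> log_weight q k <= r) -> 0 <= r ->
  x `^ (2 * q) * ln (x `^ (2 * q) / (m + b) `^ (2 * q))
    - x `^ (2 * q) + (m + b) `^ (2 * q) <= b `^ (2 * q) * (72 + 144 * r).
Proof.
have /andP[q2 q1] := hq.
move=> x0 m0 b0 hp hn r0; have zr := abs_powR_le _ _ hp hn r0.
set z := (x - m) / b in hp hn zr *.
have p12 : 0 <= 2 * q <= 2 by lra.
have p12' : 1 <= 2 * q <= 2 by lra.
have T0 : 0 < m + b by lra.
have B0 : 0 < b `^ (2 * q) by rewrite powR_gt0.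
have xE : x = m + b * z by rewrite /z mulrC divfK ?gt_eqF//; lra.
clearbody z.
have [xT|Tx] := leP x (2 * (m + b)).
  apply: le_trans (xlnx_le_powR _ _ _ x0 T0 xT p12') _.
  apply: (@le_trans _ _ (9 * (b * (`|z| + 1)) `^ (2 * q))).
    rewrite ler_pM2l// ge0_ler_powR ?nnegrE ?mulr_ge0 ?addr_ge0 ?(ltW b0)//; first by lra.
    have -> : x - (m + b) = b * (z - 1) by rewrite xE; ring.
    rewrite normrM (gtr0_norm b0) ler_pM2l// (le_trans (ler_normB _ _))//.
    by rewrite normr1.
  rewrite powRM ?addr_ge0 ?(ltW b0)//.
  rewrite mulrCA ler_pM2l//.
  have := powRD_le `|z| 1 (2 * q) (normr_ge0 _) ler01 p12.
  rewrite powR1; lra.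
have z2 : 2 < z by rewrite -(ltr_pM2l b0); lra.
have z1 : 1 <= z by lra.
have [k /andP[k1 k2]] := dyadic_itv _ z1.
have lw := hp _ k1.
have q0 : 0 <= q by lra.
have z0 : 0 <= z by lra.
have zk := powR_le_log_weight q z k hq z0 k2.
have w1 := powR4X_ge1 q k q0.
set w := (4 ^+ k) `^ q in w1 zk.
(* From x > 2 (m + b) one gets m <= b z, so x <= 2 b z. The factors 2^(2q) <= 4 and z^(2q) <= 4 w
   make 16. *)
have xle : x `^ (2 * q) <= 16 * b `^ (2 * q) * w.
  apply: (@le_trans _ _ ((2 * (b * z)) `^ (2 * q))).
    rewrite ge0_ler_powR ?nnegrE ?mulr_ge0 ?(ltW b0)//; lra.
  rewrite !powRM ?mulr_ge0 ?(ltW b0)//.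
  have := @powR2_le4 R (2 * q); case/andP: p12 => _ /[swap]/[apply] h4.
  rewrite (@le_trans _ _ (4 * (b `^ (2 * q) * (4 * w))))//; last by lra.
  apply: ler_pM; rewrite ?mulr_ge0 ?powR_ge0//.
  by rewrite ler_pM2l.
have xp0 : 0 < x `^ (2 * q) by rewrite powR_gt0//; lra.
have tb : b `^ (2 * q) <= (m + b) `^ (2 * q).
  by rewrite ge0_ler_powR ?nnegrE ?(ltW b0) ?(ltW T0)//; lra.
have tp0 : 0 < (m + b) `^ (2 * q) by rewrite powR_gt0.
have tx : (m + b) `^ (2 * q) <= x `^ (2 * q). 
  by rewrite ge0_ler_powR ?nnegrE ?(ltW T0)//; lra.
have lnle : ln (x `^ (2 * q) / (m + b) `^ (2 * q)) <= ln (16 * w).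
  rewrite ler_ln ?posrE ?divr_gt0//; last by lra.
  rewrite ler_pdivrMr// (le_trans xle)//.
  rewrite [leLHS](_ : _ = 16 * w * b `^ (2 * q)); last by ring.
  by rewrite ler_pM2l//; lra.
have ln0 : 0 <= ln (x `^ (2 * q) / (m + b) `^ (2 * q)).
  by rewrite ln_ge0// ler_pdivlMr// mul1r.
have : x `^ (2 * q) * ln (x `^ (2 * q) / (m + b) `^ (2 * q)) <=
    16 * b `^ (2 * q) * w * ln (16 * w).
  by apply: ler_pM => //; exact: ltW.
have -> : 16 * b `^ (2 * q) * w * ln (16 * w) = b `^ (2 * q) * (16 * log_weight q k).
  by rewrite /log_weight -/w; ring.
have : b `^ (2 * q) * (16 * log_weight q k) <= b `^ (2 * q) * (72 + 144 * r).
  by rewrite ler_pM2l//; lra.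
lra.
Qed.

End pointwise_bounds.

(** * Integral of the dyadic majorant; existence of a median *)

Section dyadic_integral.
Context {d} {T : measurableType d} {R : realType}.
Variable mu : probability T R.
Implicit Types g f : T -> R.

(** The bound on w capl(a) is used to trade ln w for ln (1/a): it gives w a ln 2 <= C, so 16 w <= D
    / (2a) with D = 32 C / ln 2. Both a ln (1/(2a)) and a |ln D| are controlled by capl(a). *)
Lemma log_weight_capl_le (a w C : R) : 0 <= a -> a <= 2^-1 -> 1 <= w -> 0 < C ->
  w * capl a <= C ->
  w * ln (16 * w) * a <= (1 + `|ln (32 * C / ln 2)| / ln 2) * (w * capl a).
Proof.
rewrite le_eqVlt => /predU1P[<- *|a0 a2 w1 C0 wC]; first by rewrite capl0 !mulr0.
have l2 := @ln2_gt0 R.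
have w0 : 0 < w by lra.
set D := 32 * C / ln 2.
have D0 : 0 < D by rewrite divr_gt0// mulr_gt0.
have aV0 : 0 < (2 * a)^-1 by rewrite invr_gt0 mulr_gt0.
have ca := capl_ge_ln2 a (ltW a0) a2.
have wa : w * (a * ln 2) <= C by apply: le_trans wC; rewrite ler_pM2l.
have lnw : ln (16 * w) <= ln D + ln (2 * a)^-1.
  have w16 : 0 < 16 * w by rewrite mulr_gt0.
  have DV : 0 < D * (2 * a)^-1 by apply: mulr_gt0.
  rewrite -lnM ?posrE// ler_ln ?posrE//.
  rewrite /D -mulrA -invfM ler_pdivlMr ?mulr_gt0//; lra.
have h1 := capl_ge_lnV a a0.
have h2 : a * ln D <= `|ln D| / ln 2 * capl a.
  rewrite (@le_trans _ _ (`|ln D| / ln 2 * (a * ln 2)))//; last first.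
    by rewrite ler_wpM2l// divr_ge0// ltW.
  rewrite [leRHS](_ : _ = a * `|ln D|); last by field; rewrite gt_eqF.
  by rewrite ler_pM2l// ler_norm.
have h3 : a * ln (16 * w) <= (1 + `|ln D| / ln 2) * capl a.
  apply: (@le_trans _ _ (a * (ln D + ln (2 * a)^-1))); first by rewrite ler_pM2l.
  lra.
rewrite [leLHS](_ : _ = w * (a * ln (16 * w))); last by ring.
by rewrite [leRHS]mulrCA ler_pM2l.
Qed.

Lemma level_indic g (t : R) x : (t <= g x)%R%:R = \1_[set x | (t <= g x)%R] x :> R.
Proof.
rewrite indicE; have [tx|tx] := boolP (t <= g x); first by rewrite mem_set.
by rewrite memNset//; apply/negP.
Qed.

Lemma measurable_dyadic_weight q g : 0 <= q -> measurable_fun setT g ->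
  measurable_fun setT (fun x => dyadic_weight q (g x)).
Proof.
move=> q0 mg; apply: ge0_emeasurable_sum => [k x _ _|k _].
  by rewrite lee_fin mulr_ge0 ?log_weight_ge0.
apply/measurable_EFinP/measurable_funM => //.
rewrite (_ : (fun x => _) = \1_[set x | (2 ^+ k <= g x)%R]).
  exact/measurable_indic/measurable_superlevel_ge.
by apply/funext => x; rewrite level_indic.
Qed.

Lemma integral_dyadic_weight_le q (C : R) g : 0 <= q -> 0 < C ->
  measurable_fun setT g -> (mu [set x | (0 < g x)%R] <= (2^-1)%:E)%E ->
  (forall K : nat, \sum_(k < K) (4 ^+ k) `^ q *
     capl (fine (mu [set x | (2 ^+ k <= g x)%R])) <= C) ->
  (\int[mu]_x dyadic_weight q (g x) <=
    ((1 + `|ln (32 * C / ln 2)| / ln 2) * C)%:E)%E.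
Proof.
move=> q0 C0 mg mug hC.
have mA k : measurable [set x | (2 ^+ k <= g x)%R] by exact: measurable_superlevel_ge.
pose a k := fine (mu [set x | (2 ^+ k <= g x)%R]).
have a0 k : 0 <= a k by exact/fine_ge0.
have a2 k : a k <= 2^-1.
  rewrite -lee_fin fineK ?fin_num_measure// (le_trans _ mug)// le_measure ?inE//.
    exact: measurable_superlevel_gt.
  by move=> x /=; apply: lt_le_trans; exact: exprn_gt0.
have w1 k : 1 <= (4 ^+ k : R) `^ q by exact: powR4X_ge1.
have t0 k : 0 <= (4 ^+ k) `^ q * capl (a k) by rewrite mulr_ge0 ?powR_ge0 ?capl_ge0.
set B := 1 + _.
have B0 : 0 <= B by rewrite addr_ge0// divr_ge0// ltW// ln2_gt0.
rewrite /dyadic_weight integral_nneseries//; last 2 first.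
- move=> k; apply/measurable_EFinP/measurable_funM => //.
  rewrite (_ : (fun x => _) = \1_[set x | (2 ^+ k <= g x)%R]).
    exact/measurable_indic.
  by apply/funext => x; rewrite level_indic.
- by move=> k x _; rewrite lee_fin mulr_ge0 ?log_weight_ge0.
have ik k : (\int[mu]_x (log_weight q k * (2 ^+ k <= g x)%R%:R)%:E =
    (log_weight q k * a k)%:E)%E.
  under eq_integral do rewrite level_indic EFinM.
  rewrite ge0_integralZl_EFin ?log_weight_ge0//; last exact/measurable_EFinP/measurable_indic.
  by rewrite integral_indic// setIT [RHS]EFinM /a fineK// fin_num_measure.
have pos k : (0 <= \int[mu]_x (log_weight q k * (2 ^+ k <= g x)%R%:R)%:E)%E.
  by rewrite ik lee_fin mulr_ge0 ?log_weight_ge0.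
apply: lime_le; first by apply: is_cvg_nneseries => k _ _.
apply: nearW => K; rewrite (eq_bigr _ (fun k _ => ik k)) sumEFin lee_fin big_mkord.
apply: (@le_trans _ _ (\sum_(k < K) B * ((4 ^+ k) `^ q * capl (a k)))).
  apply: ler_sum => k _; rewrite /log_weight; apply: log_weight_capl_le => //.
  (* Each single term is at most [C], being part of a partial sum of non-negative terms. *)
  apply: le_trans (hC k.+1); rewrite big_ord_recr/= lerDr.
  by apply: sumr_ge0 => j _.
by rewrite -mulr_sumr ler_wpM2l.
Qed.

Lemma measure_bigcup_le (F : (set T)^nat) (A : set T) (y : \bar R) :
  measurable A -> (forall k, measurable (F k)) -> nondecreasing_seq F ->
  A `<=` \bigcup_k F k -> (forall k, mu (F k) <= y)%E -> (mu A <= y)%E.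
Proof.
move=> mA mF ndF AF Fy.
have mU : measurable (\bigcup_k F k) by exact: bigcupT_measurable.
apply: (@le_trans _ _ (mu (\bigcup_k F k))); first by rewrite le_measure ?inE.
have h := @nondecreasing_cvg_mu _ _ _ mu _ mF mU ndF.
rewrite -(cvg_lim _ h)//; apply: lime_le; first by apply/cvg_ex; eexists; exact: h.
by apply: nearW => k; exact: Fy.
Qed.

(** The median is the infimum of the t >= 0 with mu (f > t) <= 1/2. Such t exist, since otherwise mu
    (f <= k) <= 1/2 for all k. Both strict level sets are increasing unions of level sets at
    distance 1/(k+1) from the infimum. *)
Lemma exists_median f : measurable_fun setT f -> (forall x, 0 <= f x) ->
  exists m : R, [/\ 0 <= m, (mu [set x | (m < f x)%R] <= (2^-1)%:E)%E &
    (mu [set x | (f x < m)%R] <= (2^-1)%:E)%E].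
Proof.
move=> mf f0.
have mgt (t : R) : measurable [set x | (t < f x)%R].
  exact: measurable_superlevel_gt.
have mlt (t : R) : measurable [set x | (f x < t)%R].
  have -> : [set x | (f x < t)%R] = ~` [set x | (t <= f x)%R].
    by apply/seteqP; split => x /=; rewrite ltNge => /negP.
  exact/measurableC/measurable_superlevel_ge.
have CE (t : R) : [set x | (f x <= t)%R] = ~` [set x | (t < f x)%R].
  by apply/seteqP; split => x /=; rewrite leNgt => /negP.
have mle (t : R) : measurable [set x | (f x <= t)%R].
  by rewrite CE; exact: measurableC.
have half (t : R) : ~ (mu [set x | (t < f x)%R] <= (2^-1)%:E)%E ->
    (mu [set x | (f x <= t)%R] <= (2^-1)%:E)%E.
  move=> /negP; rewrite -ltNge => h.
  rewrite CE probability_setC// leeBlDr ?fin_num_measure//.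
  rewrite (_ : 1%E = (2^-1)%:E + (2^-1)%:E)%E; last by rewrite -EFinD; congr EFin; lra.
  by rewrite leeD2l// ltW.
pose S := [set t | 0 <= t /\ (mu [set x | (t < f x)%R] <= (2^-1)%:E)%E].
have S0 : S !=set0.
  apply: contrapT => /set0P/negP/negPn/eqP SE.
  have : (mu [set: T] <= (2^-1)%:E)%E.
    apply: (@measure_bigcup_le (fun k => [set x | (f x <= k%:R)%R])) => //.
    - move=> j k jk; apply/subsetPset => x /= /le_trans; apply.
      by rewrite ler_nat.
    - move=> x _; exists (Num.truncn (f x)).+1 => //=.
      exact/ltW/truncnS_gt.
    - move=> k; apply: half => h.
      by have : S k%:R by []; rewrite SE.
  by rewrite probability_setT lee_fin; lra.
have lbS : lbound S 0 by move=> t [].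
have hS : has_inf S by split => //; exists 0.
exists (inf S); split; first exact: lb_le_inf.
- apply: (@measure_bigcup_le (fun k => [set x | (inf S + k.+1%:R^-1 < f x)%R])) => //.
  + move=> j k jk; apply/subsetPset => x /=; apply: le_lt_trans.
    by rewrite lerD2l lef_pV2 ?posrE// ler_nat.
  + by move=> x /= /ltr_add_invr[k hk]; exists k.
  + move=> k; have k0 : 0 < k.+1%:R^-1 :> R by rewrite invr_gt0.
    have [s [_ Ss] sk] := inf_adherent k0 hS.
    apply: le_trans Ss; rewrite le_measure ?inE// => x /=; exact: lt_trans.
- apply: (@measure_bigcup_le (fun k => [set x | (f x <= inf S - k.+1%:R^-1)%R])) => //.
  + move=> j k jk; apply/subsetPset => x /= /le_trans; apply.
    by rewrite lerD2l lerN2 lef_pV2 ?posrE// ler_nat.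
  + move=> x /= /ltr_add_invr[k hk]; exists k => //=.
    by rewrite lerBrDr ltW.
  (* A negative t is outside [S] by definition, but then no point satisfies f <= t. *)
  + move=> k; set t := inf S - _; have [t0|t0] := leP 0 t; last first.
      rewrite (_ : [set x | _] = set0) ?measure0 ?lee_fin//.
      apply/seteqP; split => x //= fxt.
      by have := le_lt_trans (le_trans (f0 x) fxt) t0; rewrite ltxx.
    apply: half => h; have St : S t by [].
    have : inf S <= t by apply: ge_inf => //; exists 0.
    by rewrite /t lerBrDr gerDl leNgt invr_gt0 ltr0n.
Qed.

End dyadic_integral.

(** * Bounding the entropy by a power of the energy *)

Section entropy_energy.
Context {R : realType} {n : nat} {M : ptopologicalType}.
Variable X : riemannian_manifold R n M.
Variables (mu : probability (borel M) R) (nu : {measure set (borel M) -> \bar R}).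
Variables (h : R -> R) (c q : R).
Hypothesis wls : weak_log_sobolev X mu nu h.
Hypotheses (c0 : 0 < c) (c2 : c <= 2^-1) (hq : 2^-1 <= q < 1).
Hypothesis h_int : (\int[lebesgue_measure]_(t in `]0%R, 2^-1%R[)
     (h (c * t) `^ (q / (1 - q)))%:E < +oo)%E.

Lemma C1_affine (f : M -> R) (s m : R) : C1 X f ->
  C1 X (fun x => s * (f x - m)) /\ forall x,
  grad_norm X (fun x => s * (f x - m)) x ^+ 2 = s ^+ 2 * grad_norm X f x ^+ 2.
Proof.
move=> f1; pose xi (y : R) := s * (y - m).
have dxi (y : R) : is_derive y 1 xi s.
  by apply: is_derive_eq; rewrite /GRing.scale/= subr0 mulr1.
split; first exact: (C1_comp _ f xi (fun=> s) f1 dxi (fun=> cvg_cst _)).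
by move=> x; exact: (grad_norm_comp _ f xi s x f1 (dxi _)).
Qed.

(** The square of [b] only has to dominate the energy, so that functions of zero energy can be
    treated with arbitrarily small [b]. *)
Lemma Ent_le_of_energy : exists2 C : R, 0 < C & forall (f : M -> R) (b : R),
  C1 X f -> (forall x, 0 <= f x) -> 0 < b ->
  (\int[nu]_x (grad_norm X f x ^+ 2)%:E <= (b ^+ 2)%:E)%E ->
  (Ent mu (fun x => (f x `^ (2 * q))%R) <= (C * b `^ (2 * q))%:E)%E.
Proof.
have [C C0 hC] := level_sum_bounded X mu nu h c q wls c0 c2 hq h_int.
have /andP[q2 q1] := hq; have q0 : 0 <= q by lra.
pose A := (1 + `|ln (32 * C / ln 2)| / ln 2) * C.
have A0 : 0 <= A.
  by rewrite mulr_ge0 ?(ltW C0)// addr_ge0// divr_ge0// ltW// ln2_gt0.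
(* 288 is 144 from the pointwise bound, doubled for the two sides of the median, each contributing
   at most [A]. *)
exists (72 + 288 * A); first by clearbody A; lra.
move=> f b f1 f0 b0 fE.
have mf := continuous_measurable_borel _ (C1_continuous _ _ f1).
have [m [m0 mgt mlt]] := exists_median mu f mf f0.
have bV0 : 0 < b^-1 by rewrite invr_gt0.
have energy s : s ^+ 2 = b^-1 ^+ 2 ->
    (\int[nu]_x (grad_norm X (fun x => s * (f x - m)) x ^+ 2)%:E <= 1)%E.
  move=> sE; have [_ gE] := C1_affine f s m f1.
  under eq_integral do rewrite gE sE EFinM.
  rewrite integralZl_nomeas ?exprn_gt0//; last by move=> x; rewrite lee_fin sqr_ge0.
  rewrite exprVn lee_pdivrMl ?exprn_gt0// mule1.
  exact: fE.
have affine_int s (ms : (mu [set x | (0 < s * (f x - m))%R] <= (2^-1)%:E)%E) :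
    s ^+ 2 = b^-1 ^+ 2 ->
    measurable_fun setT (fun x : borel M => dyadic_weight q (s * (f x - m))) /\
    (\int[mu]_x dyadic_weight q (s * (f x - m)) <= A%:E)%E.
  move=> sE; have [z1 _] := C1_affine f s m f1.
  have mz := continuous_measurable_borel _ (C1_continuous _ _ z1).
  split; first exact: measurable_dyadic_weight.
  apply: integral_dyadic_weight_le => //; exact: hC (energy s sE).
have zp : (mu [set x | (0 < b^-1 * (f x - m))%R] <= (2^-1)%:E)%E.
  rewrite (_ : [set x | _] = [set x | (m < f x)%R])//.
  by apply/seteqP; split => x /=; rewrite pmulr_rgt0// subr_gt0.
have [mp ip] := affine_int _ zp erefl.
have zn : (mu [set x | (0 < - b^-1 * (f x - m))%R] <= (2^-1)%:E)%E.
  rewrite (_ : [set x | _] = [set x | (f x < m)%R])//.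
  by apply/seteqP; split => x /=; rewrite mulNr -mulrN pmulr_rgt0// oppr_gt0 subr_lt0.
have [mn in_] := affine_int _ zn (sqrrN _).
pose Q (x : borel M) : \bar R := (dyadic_weight q (b^-1 * (f x - m)) +
  dyadic_weight q (- b^-1 * (f x - m)))%E.
have Q0 x : (0 <= Q x)%E by rewrite adde_ge0 ?dyadic_weight_ge0.
have mQ : measurable_fun setT Q by exact: emeasurable_funD.
have iQ : (\int[mu]_x Q x <= (2 * A)%:E)%E.
  rewrite ge0_integralD//; last 2 first.
    by move=> x _; exact: dyadic_weight_ge0.
    by move=> x _; exact: dyadic_weight_ge0.
  by rewrite mulr_natl mulr2n EFinD leeD.
have Qr x (r : R) : Q x = r%:E -> [/\
    forall k : nat, 2 ^+ k <= (f x - m) / b -> log_weight q k <= r,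
    forall k : nat, 2 ^+ k <= - ((f x - m) / b) -> log_weight q k <= r & 0 <= r].
  move=> Qx; split; last by rewrite -lee_fin -Qx.
  - move=> k; rewrite mulrC => hk; rewrite -lee_fin -Qx.
    by apply: le_trans (dyadic_weight_ge _ _ _ q0 hk) _; rewrite leeDl// dyadic_weight_ge0.
  - move=> k; rewrite mulrC -mulNr => hk; rewrite -lee_fin -Qx.
    by apply: le_trans (dyadic_weight_ge _ _ _ q0 hk) _; rewrite leeDr// dyadic_weight_ge0.
have integral_Q (s t : R) : 0 <= s -> 0 < t ->
    measurable_fun setT (fun x => s%:E + t%:E * Q x)%E /\
    (\int[mu]_x (s%:E + t%:E * Q x) <= (s + t * (2 * A))%:E)%E.
  move=> s0 t0; have mtQ : measurable_fun setT (fun x => t%:E * Q x)%E by exact: measurable_funeM.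
  split; first exact: emeasurable_funD.
  rewrite ge0_integralD//; last by move=> x _; rewrite mule_ge0// lee_fin ltW.
  rewrite integral_cst//= probability_setT mule1 ge0_integralZl_EFin//; last exact: ltW.
  by rewrite EFinD leeD2l// EFinM lee_pmul2l// lte_fin.
have B0 : 0 < b `^ (2 * q) by rewrite powR_gt0.
have mF : measurable_fun setT (fun x : borel M => f x `^ (2 * q)).
  by apply: (measurableT_comp (measurable_powR (2 * q))).
have F0 x : 0 <= f x `^ (2 * q) by exact: powR_ge0.
(* Finiteness comes first, as [Ent] is [+oo] by definition otherwise. Where [Q] is infinite the
   majorant is infinite and nothing is to be proved. *)
have iF : (\int[mu]_x (f x `^ (2 * q))%:E != +oo)%E.
  have s0 : 0 <= 4 * (m `^ (2 * q) + b `^ (2 * q)).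
    by rewrite mulr_ge0// addr_ge0 ?powR_ge0.
  have t0 : 0 < 16 * b `^ (2 * q) by rewrite mulr_gt0.
  have [mH iH] := integral_Q _ _ s0 t0.
  rewrite lt_eqF//; apply: le_lt_trans (ltry (4 * (m `^ (2 * q) + b `^ (2 * q)) +
    16 * b `^ (2 * q) * (2 * A))).
  apply: le_trans iH; apply: le_integral_nomeas => x; first by rewrite lee_fin.
  move: (Q0 x) (Qr x); case: (Q x) => [r| |]//; last first.
    by move=> _ _; rewrite gt0_muley ?lte_fin// addey// leey.
  move=> _ /(_ r erefl) [hp hn r0]; rewrite -EFinM -EFinD lee_fin.
  have := shifted_powR_le q hq (f x) m b r (f0 x) m0 b0 hp hn r0; lra.
have t0 : 0 < (m + b) `^ (2 * q) by rewrite powR_gt0// ltr_wpDl.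
have s0 : 0 <= 72 * b `^ (2 * q) by rewrite mulr_ge0// ltW.
have s1 : 0 < 144 * b `^ (2 * q) by rewrite mulr_gt0.
have [mH iH] := integral_Q _ _ s0 s1.
rewrite [leRHS](_ : _ = (72 * b `^ (2 * q) + 144 * b `^ (2 * q) * (2 * A))%:E); last first.
  by congr EFin; ring.
apply: le_trans iH.
apply: (Ent_le mu (fun x => f x `^ (2 * q)) _ _ t0 mF F0 iF mH).
  by move=> x; rewrite adde_ge0 ?mule_ge0 ?lee_fin// ltW.
move=> x; move: (Q0 x) (Qr x); case: (Q x) => [r| |]//; last first.
  by move=> _ _; rewrite gt0_muley ?lte_fin// addey// leey.
move=> _ /(_ r erefl) [hp hn r0]; rewrite -EFinM -EFinD lee_fin.
have := entropy_density_le q hq (f x) m b r (f0 x) m0 b0 hp hn r0; lra.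
Qed.

End entropy_energy.

(** * The inequality for all energies, by homogeneity *)

Theorem corollary3p8 (R : realType) (n : nat) (M : ptopologicalType)
    (X : riemannian_manifold R n M)
    (mu : probability (borel M) R) (nu : {measure set (borel M) -> \bar R})
    (q : R) (hq : 2^-1 <= q < 1) (hWLS : R -> R) :
  let c : R := ln 2 / (2 * ln (1 + 2 * expR 1 ^+ 2)) in
  weak_log_sobolev X mu nu hWLS ->
  (\int[lebesgue_measure]_(t in `]0%R, 2^-1%R[)
     (hWLS (c * t) `^ (q / (1 - q)))%:E < +oo)%E ->
  Lq_log_sobolev X mu nu q.
Proof.
move=> c wls h_int; have /andP[q2 q1] := hq.
have q0 : 0 < q by lra.
have l2 := @ln2_gt0 R.
have e1 : 1 <= (expR 1 : R) ^+ 2 by rewrite exprn_ege1// -[leLHS]expR0 ler_expR.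
(* This amounts to c <= 1/2, which is what compares the integral of the hypothesis with the Riemann
   sum. *)
have lE : ln 2 <= ln (1 + 2 * (expR 1 : R) ^+ 2) by rewrite ler_ln ?posrE//; lra.
have lE0 : 0 < ln (1 + 2 * (expR 1 : R) ^+ 2) by exact: lt_le_trans lE.
have c0 : 0 < c by rewrite divr_gt0// mulr_gt0.
have c2 : c <= 2^-1 by rewrite /c ler_pdivrMr ?mulr_gt0//; lra.
have [C C0 hC] := Ent_le_of_energy X mu nu hWLS c q wls c0 c2 hq h_int.
exists (C `^ q^-1); first by rewrite powR_gt0.
move=> f f1 f0.
have mf := continuous_measurable_borel _ (C1_continuous _ _ f1).
set En := Ent _ _.
have Ent0 : (0 <= En)%E.
  apply: Ent_ge0; last by move=> x; exact: powR_ge0.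
  by apply: (measurableT_comp (measurable_powR (2 * q))).
have : (0 <= \int[nu]_x (grad_norm X f x ^+ 2)%:E)%E.
  by apply: integral_ge0 => x _; rewrite lee_fin sqr_ge0.
case E : (\int[nu]_x _)%E => [e| |]//; last first.
  by move=> _; rewrite gt0_muley ?leey// lte_fin powR_gt0.
(* For positive energy e take b = sqrt e: the bound C e^q, raised to the power 1/q, is C^(1/q) e. *)
rewrite lee_fin le_eqVlt => /predU1P[e0|e0]; last first.
  have hE := hC f (Num.sqrt e) f1 f0; rewrite sqrtr_gt0 sqr_sqrtr ?(ltW e0)// E in hE.
  have {hE} : (En <= (C * Num.sqrt e `^ (2 * q))%:E)%E := hE e0 (lexx _).
  rewrite powRrM powR_mulrn ?sqrtr_ge0// sqr_sqrtr ?(ltW e0)//.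
  clearbody En; move: Ent0; case: En => [a| |]// Ea0 EaC.
  have a0 : 0 <= a by rewrite -lee_fin.
  have aC : a <= C * e `^ q by rewrite -lee_fin.
  rewrite poweR_EFin -EFinM lee_fin.
  rewrite (@le_trans _ _ ((C * e `^ q) `^ q^-1))//.
    by rewrite ge0_ler_powR ?nnegrE ?invr_ge0 ?mulr_ge0 ?powR_ge0 ?(ltW q0) ?(ltW C0).
  by rewrite powRM ?powR_ge0 ?(ltW C0)// -powRrM divff ?gt_eqF// powRr1 ?(ltW e0)//.
suff -> : En = 0%E.
  by rewrite poweR0r ?invr_neq0 ?gt_eqF// -e0 mule0.
have hE (b : R) : 0 < b ->
    (En <= (C * b `^ (2 * q))%:E)%E.
  by move=> b0; apply: hC => //; rewrite E -e0 lee_fin sqr_ge0.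
have := hE 1 ltr01.
clearbody En; move: Ent0 hE; case: En => [a| |]//; rewrite lee_fin => a0 hE _.
move: a0; rewrite le_eqVlt => /predU1P[<-//|a0].
(* With zero energy every b > 0 is admissible; this one makes the bound a / 2, contradicting a >
   0. *)
pose b := (a / (2 * C)) `^ (2 * q)^-1.
have aC : 0 < a / (2 * C) by rewrite divr_gt0// mulr_gt0.
have := hE b; rewrite powR_gt0// => /(_ isT).
rewrite -powRrM mulVf ?mulf_neq0 ?gt_eqF// powRr1 ?(ltW aC)// lee_fin.
have -> : C * (a / (2 * C)) = a / 2 by field; rewrite gt_eqF.
by move=> ?; exfalso; lra.
Qed.
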